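(* There is an absolute constant $C>0$ such that the following holds. Let $N,n\in\mathbb N$ with $n$ dividing $N$, let $\epsilon>0$, and let $\Psi$ contain only the two uniform $n$-block strings in $\{0,1\}^N$. There is a retention rate $\rho\in(0,1)$ with $\rho N\le C\left(\frac{n}{\epsilon}+\frac{n}{\epsilon^2\log n}\right)$ and a $(\Psi,\mathrm{far}^{\mathrm{rel\text{-}edit}}_\epsilon(\Psi),\rho,2/3)$-trace tester using one trace.
   Context: The 1-uniform $n$-block string is $1^{N/n}0^{N/n}1^{N/n}\cdots$ ($n$ blocks of length $N/n$, the $i$-th with symbol $i\bmod 2$) and the 0-uniform $n$-block string is its complement $0^{N/n}1^{N/n}\cdots$; these are the uniform $n$-block strings. For $x\in\{0,1\}^N$, a trace with retention rate $\rho$ deletes each character independently with probability $1-\rho$. A $(\Psi_1,\Psi_2,\rho,\alpha)$-trace tester using $k$ traces receives $k$ independent traces of the unknown $x$, accepts with probability $\ge\alpha$ if $x\in\Psi_1$ and rejects with probability $\ge\alpha$ if $x\in\Psi_2$. $d_{\mathrm{rel\text{-}edit}}(x,y)=\frac{2}{N+M}\mathrm{ed}(x,y)$ with $\mathrm{ed}$ the standard edit distance; $\mathrm{far}^{\mathrm{rel\text{-}edit}}_\epsilon(\Psi)=\{x\in\{0,1\}^N:\min_{y\in\Psi}d_{\mathrm{rel\text{-}edit}}(x,y)>\epsilon\}$. $\log$ is the natural logarithm. *)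

(* Defs.v *)
From mathcomp Require Import all_boot all_order all_algebra.
From mathcomp Require Import all_classical all_reals all_analysis.

Set Implicit Arguments.
Unset Strict Implicit.
Unset Printing Implicit Defensive.

Import Order.TTheory GRing.Theory Num.Theory.

Local Open Scope ring_scope.

(** Edit distance: the least number of single-character insertions, deletions
    and substitutions that turn one string into the other. *)

Inductive edit_step : seq bool -> seq bool -> Prop :=
| edit_insertion u b v : edit_step (u ++ v) (u ++ b :: v)
| edit_deletion u b v : edit_step (u ++ b :: v) (u ++ v)
| edit_substitution u b c v : edit_step (u ++ b :: v) (u ++ c :: v).

Fixpoint edit_path (k : nat) (x y : seq bool) : Prop :=
  if k is k'.+1 then exists2 z, edit_step x z & edit_path k' z y else x = y.

Lemma edit_path_exists (x y : seq bool) : exists k, `[< edit_path k x y >].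
Proof.
have cons_path j u v b : edit_path j u v -> edit_path j.+1 u (b :: v).
  elim: j u => [u <-|j IHj u [z uz /IHj zv]]; last by exists z.
  by exists (b :: u) => //; exact: (edit_insertion [::] b u).
suff [k xy] : exists k, edit_path k x y by exists k; apply/asboolP.
elim: x => [|b x [k xy]].
  elim: y => [|b y [k /cons_path]]; first by exists 0%N.
  by exists k.+1.
by exists k.+1, x => //; exact: (edit_deletion [::] b x).
Qed.

Definition edit_dist (x y : seq bool) : nat := ex_minn (edit_path_exists x y).

Definition rel_edit_dist (R : realType) (x y : seq bool) : R :=
  2 / (size x + size y)%:R * (edit_dist x y)%:R.

Definition far_rel_edit (R : realType) (N : nat) (eps : R)
    (Psi : {set N.-tuple bool}) : {set N.-tuple bool} :=
  [set x : N.-tuple bool |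
    (eps%:E < \big[Order.min/+oo]_(y in Psi) (rel_edit_dist R x y)%:E)%E].

(** The symbols 0 and 1 are [false] and [true]. *)

Definition one_uniform (N n : nat) : seq bool :=
  flatten [seq nseq (N %/ n) (odd i) | i <- iota 1 n].

Definition zero_uniform (N n : nat) : seq bool := map negb (one_uniform N n).

(** When [n] divides [N] both strings have length [N]. *)
Definition uniform_block_strings (N n : nat) : {set N.-tuple bool} :=
  [set x : N.-tuple bool |
    (tval x == one_uniform N n) || (tval x == zero_uniform N n)].

(** A retention pattern [m] marks the characters that are kept, so that the
    trace of [x] is [mask m x]; each character is kept independently with
    probability [rho]. *)
Definition retention_prob (R : realType) (N : nat) (rho : R)
    (m : N.-tuple bool) : R :=
  \prod_(i < N) (if tnth m i then rho else 1 - rho).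

(** Expectation of [f] over [k] independent traces of [x]. *)
Definition trace_expectation (R : realType) (N k : nat) (rho : R)
    (x : N.-tuple bool) (f : k.-tuple (seq bool) -> R) : R :=
  \sum_(m : {ffun 'I_k -> N.-tuple bool})
    (\prod_(j < k) retention_prob rho (m j)) *
    f [tuple mask (m j) x | j < k].

(** Testers may be randomized: [A t] is the probability, over the internal
    randomness, that the tester accepts when it is given the traces [t]. *)
Definition trace_tester (R : realType) (N k : nat)
    (Psi1 Psi2 : {set N.-tuple bool}) (rho alpha : R)
    (A : k.-tuple (seq bool) -> R) : Prop :=
  [/\ forall t, 0 <= A t <= 1,
      forall x, x \in Psi1 -> alpha <= trace_expectation rho x A
    & forall x, x \in Psi2 ->
        alpha <= trace_expectation rho x (fun t => 1 - A t)].

(* Main.v *)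
Require Import Defs.
From mathcomp Require Import all_boot all_order all_algebra.
From mathcomp Require Import all_classical all_reals all_analysis.
From mathcomp Require Import ring lra zify.

(** Write [L = N / n], [lam = r L] and [rho = 1 - (1 - r)^3].  A kept symbol can
    be coloured at random so that a single trace at rate [rho] looks like three
    independent samples of [x] at rate [r].  The first sample labels each
    position by the last sampled symbol to its left; the runs of this labelling
    cut [x] into pieces that do not depend on the other two samples.  Let [T] be
    the number of pieces, [D] the number of symbols of the second sample that
    disagree with the label of their position, [B_i] and [B'_i] the numbers of
    symbols of the second and third sample in piece [i], and
    [Z = sum_i (B_i - lam) (B'_i - lam) + (n - T) lam^2].
    The tester rejects if [T > n], [D > 24 n] or [Z > 300 (n + sqrt n lam)].

    Given the first sample, [Z] has mean [r^2 S], where [S] is the sum of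
    [(l_i - L)^2] over the piece lengths [l_i], padded by zeros to [n] of them.
    For a uniform string, [D] has mean at most [n] and [Z] has mean [O(n)].  If
    [x] is far and [T <= n], either the labelling has more than [eps N / 2]
    errors, which makes [D] large, or the [|l_i - L|] add up to [eps N / 2], and
    then [r^2 S >= eps^2 lam^2 n / 4], which exceeds both [n] and the standard
    deviation [sqrt n lam] because [lam >= C / eps] and
    [lam >= C / (eps^2 ln n) >= C / (2 eps^2 sqrt n)]. *)

Set Implicit Arguments.
Unset Strict Implicit.
Unset Printing Implicit Defensive.

Import Order.TTheory GRing.Theory Num.Theory.

Local Open Scope ring_scope.

(** * Means over random retention patterns *)

(** Here [m] is a pattern of length [N] whose entries are independently [true]
    with probability [r]. *)
Fixpoint mask_mean (R : realFieldType) (r : R) (N : nat)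
    (F : seq bool -> R) : R :=
  if N is k.+1 then
    r * mask_mean r k (fun m => F (true :: m)) +
    (1 - r) * mask_mean r k (fun m => F (false :: m))
  else F [::].

Lemma eq_mask_mean (R : realFieldType) (r : R) N F G :
  (forall m, size m = N -> F m = G m) -> mask_mean r N F = mask_mean r N G.
Proof.
elim: N F G => [|N IHN] F G FG /=; first exact: FG.
by congr (_ * _ + _ * _); apply: IHN => m sm; apply: FG; rewrite /= sm.
Qed.

Lemma mask_meanD (R : realFieldType) (r : R) N F G :
  mask_mean r N (fun m => F m + G m) = mask_mean r N F + mask_mean r N G.
Proof. by elim: N F G => [|N IHN] F G //=; rewrite !IHN; ring. Qed.

Lemma mask_meanZ (R : realFieldType) (r : R) N a F :
  mask_mean r N (fun m => a * F m) = a * mask_mean r N F.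
Proof. by elim: N F => [|N IHN] F //=; rewrite !IHN; ring. Qed.

Lemma mask_mean_cst (R : realFieldType) (r : R) N a :
  mask_mean r N (fun=> a) = a.
Proof. by elim: N => [|N IHN] //=; rewrite !IHN; ring. Qed.

Lemma mask_mean_lin (R : realFieldType) (r : R) N a b F G :
  mask_mean r N (fun m => a * F m + b * G m) =
  a * mask_mean r N F + b * mask_mean r N G.
Proof. by rewrite mask_meanD !mask_meanZ. Qed.

Lemma mask_mean_lin2 (R : realFieldType) (r : R) N M a b
    (F G : seq bool -> seq bool -> R) :
  mask_mean r N (fun m => mask_mean r M (fun m' => a * F m m' + b * G m m')) =
  a * mask_mean r N (fun m => mask_mean r M (F m)) +
  b * mask_mean r N (fun m => mask_mean r M (G m)).
Proof.
by rewrite -mask_mean_lin; apply: eq_mask_mean => m _; exact: mask_mean_lin.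
Qed.

Lemma le_mask_mean (R : realFieldType) (r : R) N F G : 0 <= r <= 1 ->
  (forall m, size m = N -> F m <= G m) -> mask_mean r N F <= mask_mean r N G.
Proof.
move=> /andP[r0 r1]; elim: N F G => [|N IHN] F G FG /=; first exact: FG.
by apply: lerD; apply: ler_wpM2l; rewrite ?subr_ge0 //; apply: IHN => m sm;
  apply: FG; rewrite /= sm.
Qed.

Lemma mask_mean_cat (R : realFieldType) (r : R) N1 N2 F :
  mask_mean r (N1 + N2) F =
  mask_mean r N1 (fun m1 => mask_mean r N2 (fun m2 => F (m1 ++ m2))).
Proof. by elim: N1 F => [|N1 IHN] F //=; rewrite !IHN. Qed.

Lemma mask_mean_swap (R : realFieldType) (r : R) N1 N2 (F : seq bool -> seq bool -> R) :
  mask_mean r N1 (fun m1 => mask_mean r N2 (F m1)) =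
  mask_mean r N2 (fun m2 => mask_mean r N1 (fun m1 => F m1 m2)).
Proof. by elim: N1 F => [|N1 IHN] F //=; rewrite !IHN mask_mean_lin. Qed.

(** Summing out the first entry of the pattern is one step of the recursion, so the product weights
    become nested means. *)
Lemma tuple_sum_mask_mean (R : realType) (rho : R) N (F : seq bool -> R) :
  \sum_(m : N.-tuple bool) retention_prob rho m * F m = mask_mean rho N F.
Proof.
elim: N F => [|N IHN] F /=.
  rewrite (big_pred1 [tuple]) => [|m]; last by apply/esym/eqP/val_inj; case: m => -[].
  by rewrite /retention_prob big_ord0 mul1r.
rewrite (reindex (fun p : bool * N.-tuple bool => [tuple of p.1 :: p.2])) /=; last first.
  exists (fun t : N.+1.-tuple bool => (thead t, [tuple of behead t])) => [[b t] _|t _] /=.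
    by congr pair; apply/val_inj.
  by rewrite [in RHS](tuple_eta t); apply/val_inj.
rewrite -!IHN -(pair_bigA _ (fun b (t : N.-tuple bool) =>
   retention_prob rho [tuple of b :: t] * F (b :: t))) /= big_bool /= !mulr_sumr.
by congr (_ + _); apply: eq_bigr => t _; rewrite /retention_prob big_ord_recl tnth0
  mulrA; congr (_ * _ * _); apply: eq_bigr => i _; rewrite tnthS.
Qed.

Lemma trace_expectation1 (R : realType) N (rho : R) (x : N.-tuple bool)
    (f : 1.-tuple (seq bool) -> R) :
  trace_expectation rho x f =
  mask_mean rho N (fun m => f [tuple mask m x]).
Proof.
rewrite -tuple_sum_mask_mean /trace_expectation.
rewrite (reindex (fun t : N.-tuple bool => [ffun _ : 'I_1 => t])) /=; last first.
  exists (fun m => m ord0) => [t _|m _]; first by rewrite ffunE.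
  by apply/ffunP => i; rewrite ffunE (ord1 i).
apply: eq_bigr => t _; rewrite big_ord1 ffunE; congr (_ * f _).
by apply: eq_from_tnth => i; rewrite ord1 tnth_mktuple ffunE.
Qed.

(** Which of the three samples a symbol belongs to. *)
Definition colour : Type := bool * bool * bool.

Definition kept (e : bool * colour) : bool := e.2.1.1 || e.2.1.2 || e.2.2.

Definition colour_prob (R : realFieldType) (r : R) (c : colour) : R :=
  (if c.1.1 then r else 1 - r) * (if c.1.2 then r else 1 - r) *
  (if c.2 then r else 1 - r).

(** The colours of the symbols of [y] are independent, each with the law of a
    colour conditioned on belonging to at least one sample. *)
Fixpoint colour_mean (R : realFieldType) (r : R) (y : seq bool)
    (F : seq (bool * colour) -> R) : R :=
  if y is b :: y' then
    \sum_(c : bool * bool * bool | kept (b, c))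
      colour_prob r c / (1 - (1 - r) ^+ 3) *
      colour_mean r y' (fun l => F ((b, c) :: l))
  else F [::].

Definition annotate (x m1 m2 m3 : seq bool) : seq (bool * colour) :=
  zip x (zip (zip m1 m2) m3).

Lemma sum_colour (R : realFieldType) (F : bool * bool * bool -> R) (P : pred (bool * bool * bool)) :
  \sum_(c | P c) F c =
  \sum_(a : bool) \sum_(b : bool) \sum_(c : bool) if P (a, b, c) then F (a, b, c) else 0.
Proof.
rewrite big_mkcond pair_bigA pair_bigA /=.
by apply: eq_bigr => -[[a b] c] _.
Qed.

(** A symbol lies in at least one of three independent samples at rate [r] with probability
    [1 - (1 - r)^3], and [colour_mean] draws its colour from the conditional law. Colouring one
    trace thus simulates the three samples, up to the symbols that none of them contains. *)
Lemma colour_mean_mask (R : realFieldType) (r : R) (x : seq bool) F : 0 < r < 1 ->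
  mask_mean (1 - (1 - r) ^+ 3) (size x) (fun m => colour_mean r (mask m x) F) =
  mask_mean r (size x) (fun m1 => mask_mean r (size x) (fun m2 =>
    mask_mean r (size x) (fun m3 =>
      F [seq e <- annotate x m1 m2 m3 | kept e]))).
Proof.
move=> /andP[r0 r1]; elim: x F => [|b x IHx] F //=.
have rho0 : 1 - (1 - r) ^+ 3 != 0.
  have -> : 1 - (1 - r) ^+ 3 = r * (3 - 3 * r + r ^+ 2) by ring.
  by rewrite mulf_neq0 ?gt_eqF //; nra.
(* The seven colours of a kept symbol match the trace side after the normalisation cancels; the
   eighth, of weight [(1 - r)^3], matches a deleted symbol. *)
under eq_mask_mean => m sm do rewrite sum_colour /= !big_bool /= /colour_prob /=.
do ! rewrite ?mask_meanD ?mask_meanZ ?mask_mean_cst /=.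
rewrite !IHx /annotate /= !mask_mean_lin2; field.
by rewrite rho0.
Qed.

(** * Pieces and edit distance *)

(** In [changes], [errors], [hits] and [pieces], [m] is the first sample of [x]
    and [b'] is the label of the current position, that is, the last sampled
    symbol, or the initial guess [b] if there is none yet. *)
Fixpoint changes (b : bool) (x m : seq bool) : nat :=
  match x, m with
  | c :: x', k :: m' =>
      let b' := if k then c else b in ((b' != b) + changes b' x' m')%N
  | _, _ => 0
  end.

Fixpoint errors (b : bool) (x m : seq bool) : nat :=
  match x, m with
  | c :: x', k :: m' =>
      let b' := if k then c else b in ((c != b') + errors b' x' m')%N
  | _, _ => 0
  end.

Fixpoint hits (b : bool) (x m m' : seq bool) : nat :=
  match x, m, m' with
  | c :: x', k :: m1, k' :: m1' =>
      let b' := if k then c else b in ((k' && (c != b')) + hits b' x' m1 m1')%N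
  | _, _, _ => 0
  end.

Definition incr_head (ls : seq nat) : seq nat :=
  if ls is l :: ls' then l.+1 :: ls' else [:: 1%N].

Fixpoint pieces (b : bool) (x m : seq bool) : seq nat :=
  match x, m with
  | c :: x', k :: m' =>
      let b' := if k then c else b in
      let ls := incr_head (pieces b' x' m') in
      if b' != b then 0%N :: ls else ls
  | _, _ => [:: 0%N]
  end.

Fixpoint blocks (b : bool) (ls : seq nat) : seq bool :=
  if ls is l :: ls' then nseq l b ++ blocks (~~ b) ls' else [::].

Lemma pieces_cons b x m : exists l ls, pieces b x m = l :: ls.
Proof.
case: x m => [|c x] [|k m] /=; try by exists 0%N, [::].
case: ifP => _; first by eexists; eexists.
by case: pieces => [|l ls] /=; eexists; eexists.
Qed.

Lemma size_incr_head ls : size (incr_head ls) = maxn 1 (size ls).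
Proof. by case: ls => [|l ls] //=; rewrite maxnE; lia. Qed.

Lemma size_pieces b x m : size (pieces b x m) = (changes b x m).+1.
Proof.
elim: x m b => [|c x IHx] [|k m] b //=.
by case: ifP => _ /=; rewrite size_incr_head IHx; lia.
Qed.

Lemma sumn_pieces b x m : size m = size x -> sumn (pieces b x m) = size x.
Proof.
elim: x m b => [|c x IHx] [|k m] b //= [/IHx sm].
set b' := if k then c else b.
move: (sm b'); have [l [ls ->]] := pieces_cons b' x m.
by case: ifP => _ /=; lia.
Qed.

Lemma edit_path_cat p k x y : edit_path k x y -> edit_path k (p ++ x) (p ++ y).
Proof.
elim: k x => [|k IHk] x /=; first by move=> ->.
case=> z xz /IHk zy; exists (p ++ z) => //.
by case: xz => u b; last move=> c; move=> v; rewrite !catA; constructor.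
Qed.

Lemma edit_path_trans j k x y z :
  edit_path j x y -> edit_path k y z -> edit_path (j + k) x z.
Proof.
elim: j x => [|j IHj] x /=; first by move=> ->.
by case=> t xt /IHj ty /ty; exists t.
Qed.

(** Substituting its label for each mislabelled symbol produces the alternating string with the
    pieces as block lengths. *)
Lemma edit_path_errors b x m : size m = size x ->
  edit_path (errors b x m) x (blocks b (pieces b x m)).
Proof.
elim: x m b => [|c x IHx] [|k m] b //= [/IHx xw].
move: (if k then c else b) => b'.
have {xw} : edit_path ((c != b') + errors b' x m) (c :: x)
    (blocks b' (incr_head (pieces b' x m))).
  move: (xw b'); have [l [ls ->]] := pieces_cons b' x m => {}xw /=.
  apply: (@edit_path_trans _ _ _ (b' :: x)); last exact: (edit_path_cat [:: b']).
  case: (eqVneq c b') => [->//|_] /=.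
  by exists (b' :: x) => //; exact: (edit_substitution [::]).
(* A label change puts an empty piece in front, which flips the starting symbol of [blocks] and
   leaves the string unchanged. *)
by case: b' b => -[].
Qed.

(** One of the two truncated differences is zero, so their sum is [|l - l'|]. *)
Lemma edit_path_nseq b l l' s :
  edit_path ((l - l') + (l' - l)) (nseq l b ++ s) (nseq l' b ++ s).
Proof.
elim: l l' => [|l IHl] [|l'].
- by [].
- rewrite sub0n add0n subn0; elim: l'.+1 s => [|k IHk] s //=.
  exists (b :: s); first exact: (edit_insertion [::]).
  suff -> : b :: (nseq k b ++ s) = nseq k b ++ b :: s by exact: IHk.
  by elim: k {IHk} => //= k ->.
- rewrite subn0 sub0n addn0; elim: l.+1 => [|k IHk] //=.
  by exists (nseq k b ++ s) => //; exact: (edit_deletion [::]).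
- by rewrite !subSS; exact: (edit_path_cat [:: b]).
Qed.

(** Pieces are matched with blocks in order and resized; each of the [n - size ls] blocks left over
    is inserted whole at cost [L]. *)
Lemma edit_path_blocks b ls n L : (size ls <= n)%N ->
  edit_path (\sum_(l <- ls) ((l - L) + (L - l)) + (n - size ls) * L)
    (blocks b ls) (blocks b (nseq n L)).
Proof.
elim: n b ls => [|n IHn] b [|l ls] //= sn; rewrite ?big_nil ?big_cons //.
  have := IHn (~~ b) [::] isT; rewrite big_nil /= subn0 add0n => nP.
  rewrite mulSn add0n addnC. apply: (edit_path_trans nP).
  by have := edit_path_nseq b 0 L (blocks (~~ b) (nseq n L)); rewrite sub0n add0n subn0.
rewrite subSS -addnA addnC.
apply: (@edit_path_trans _ _ _ (nseq l b ++ blocks (~~ b) (nseq n L))).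
  by apply: edit_path_cat; exact: IHn.
exact: edit_path_nseq.
Qed.

Lemma edit_dist_le k x y : edit_path k x y -> (edit_dist x y <= k)%N.
Proof.
by move=> xy; rewrite /edit_dist; case: ex_minnP => j _; apply; apply/asboolP.
Qed.

Lemma edit_dist_blocks b x m n L : size m = size x -> (changes b x m < n)%N ->
  (edit_dist x (blocks b (nseq n L)) <= errors b x m +
    (\sum_(l <- pieces b x m) ((l - L) + (L - l)) + (n - (changes b x m).+1) * L))%N.
Proof.
move=> sm xn; apply: edit_dist_le.
apply: edit_path_trans (edit_path_errors b sm) _.
by rewrite -size_pieces; apply: edit_path_blocks; rewrite size_pieces.
Qed.

Lemma one_uniform_blocks N n : one_uniform N n = blocks true (nseq n (N %/ n)%N).
Proof.
rewrite /one_uniform; move: (N %/ n)%N => L; rewrite -[true]/(odd 1).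
elim: n 1%N => [|n IHn] i //=; by rewrite IHn.
Qed.

Lemma map_negb_blocks b ls : map negb (blocks b ls) = blocks (~~ b) ls.
Proof. by elim: ls b => [|l ls IHls] b //=; rewrite map_cat map_nseq IHls. Qed.

Lemma size_blocks b ls : size (blocks b ls) = sumn ls.
Proof. by elim: ls b => [|l ls IHls] b //=; rewrite size_cat size_nseq IHls. Qed.

(** The bound for the wrong initial guess is carried along because it is the one needed on entering
    the next block. *)
Lemma changes_blocks b ls m : size m = sumn ls ->
  (changes b (blocks b ls) m <= (size ls).-1)%N /\
  (changes (~~ b) (blocks b ls) m <= size ls)%N.
Proof.
elim: ls b m => [|l ls IHls] b m /=; first by case: m.
elim: l m => [|l IHl] m /=.
  rewrite add0n => /(IHls (~~ b)) [h1 h2]; rewrite negbK in h2.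
  by split; lia.
case: m => [|k m] //; rewrite addSn => -[/IHl [h1 h2]] /=.
have -> : (if k then b else b) = b by case: k.
rewrite eqxx /= add0n; split=> //.
by case: k; rewrite /= ?eqxx //; case: b {IHls IHl} h1 h2 => /=; lia.
Qed.

Lemma mem_uniform N n b (x : N.-tuple bool) : 
  tval x = blocks b (nseq n (N %/ n)%N) -> x \in uniform_block_strings N n.
Proof.
move=> xb; rewrite inE xb /zero_uniform one_uniform_blocks map_negb_blocks.
by case: b {xb}; rewrite eqxx ?orbT.
Qed.

Lemma uniformP N n (x : N.-tuple bool) : x \in uniform_block_strings N n ->
  exists b, tval x = blocks b (nseq n (N %/ n)%N).
Proof.
rewrite inE /zero_uniform one_uniform_blocks map_negb_blocks.
by case/orP => /eqP ->; eexists.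
Qed.

Lemma far_edit_dist (R : realType) N n (eps : R) b (x : N.-tuple bool) :
  (n %| N)%N -> 0 < eps -> x \in far_rel_edit eps (uniform_block_strings N n) ->
  (0 < N)%N /\ eps * N%:R < (edit_dist x (blocks b (nseq n (N %/ n)%N)))%:R.
Proof.
move=> nN eps0; rewrite inE.
have sb : size (blocks b (nseq n (N %/ n)%N)) == N.
  by rewrite size_blocks sumn_nseq mulnC; apply/eqP; rewrite mulnC divnK.
pose y : N.-tuple bool := Tuple sb.
have yU : y \in uniform_block_strings N n by exact: (@mem_uniform _ _ b).
move=> /lt_le_trans /(_ (bigmin_le_cond _ _ yU)).
rewrite lte_fin /rel_edit_dist !size_tuple /= addnn -mul2n natrM.
move: (edit_dist x _)%:R => d; have [->|N0] := posnP N.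
  by rewrite mulr0 invr0 mulr0 mul0r => /(lt_trans eps0); rewrite ltxx.
have N0' : 0 < N%:R :> R by rewrite ltr0n.
by rewrite invfM mulrA divff ?pnatr_eq0 // mul1r ltr_pdivlMl // mulrC.
Qed.

(** * The statistics of the tester *)

(** This statistic and the next two read coloured symbols without their positions in [x]; symbols of
    no sample do not affect them, so a coloured trace determines them. *)
Fixpoint seen_changes (b : bool) (l : seq (bool * colour)) : nat :=
  if l is e :: l' then
    let b' := if e.2.1.1 then e.1 else b in ((b' != b) + seen_changes b' l')%N
  else 0.

Fixpoint seen_errors (b : bool) (l : seq (bool * colour)) : nat :=
  if l is e :: l' then
    let b' := if e.2.1.1 then e.1 else b in
    ((e.2.1.2 && (e.1 != b')) + seen_errors b' l')%N
  else 0.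

(** [p] and [q] count the symbols of the second and third sample in the
    current piece. *)
Fixpoint seen_products (R : realFieldType) (lam : R) (b : bool) (p q : nat)
    (l : seq (bool * colour)) : R :=
  if l is e :: l' then
    let b' := if e.2.1.1 then e.1 else b in
    if b' != b then
      (p%:R - lam) * (q%:R - lam) +
      seen_products lam b' e.2.1.2 e.2.2 l'
    else seen_products lam b' (p + e.2.1.2) (q + e.2.2) l'
  else (p%:R - lam) * (q%:R - lam).

Lemma seen_changes_kept b l :
  seen_changes b [seq e <- l | kept e] = seen_changes b l.
Proof.
elim: l b => [|[c [[k1 k2] k3]] l IHl] b //=.
by case: k1 k2 k3 => -[] [] /=; rewrite ?IHl ?eqxx.
Qed.

Lemma seen_errors_kept b l :
  seen_errors b [seq e <- l | kept e] = seen_errors b l.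
Proof.
elim: l b => [|[c [[k1 k2] k3]] l IHl] b //=.
by case: k1 k2 k3 => -[] [] /=; rewrite ?IHl ?eqxx.
Qed.

Lemma seen_products_kept (R : realFieldType) (lam : R) b p q l :
  seen_products lam b p q [seq e <- l | kept e] = seen_products lam b p q l.
Proof.
elim: l b p q => [|[c [[k1 k2] k3]] l IHl] b p q //=.
by case: k1 k2 k3 => -[] [] /=; rewrite ?IHl ?eqxx ?addn0.
Qed.

Lemma seen_changes_annotate b x m1 m2 m3 :
  size m1 = size x -> size m2 = size x -> size m3 = size x ->
  seen_changes b (annotate x m1 m2 m3) = changes b x m1.
Proof.
rewrite /annotate; elim: x b m1 m2 m3 => [|c x IHx] b [|k1 m1] [|k2 m2] [|k3 m3] //=.
by move=> [s1] [s2] [s3]; rewrite IHx.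
Qed.

Lemma seen_errors_annotate b x m1 m2 m3 :
  size m1 = size x -> size m2 = size x -> size m3 = size x ->
  seen_errors b (annotate x m1 m2 m3) = hits b x m1 m2.
Proof.
rewrite /annotate; elim: x b m1 m2 m3 => [|c x IHx] b [|k1 m1] [|k2 m2] [|k3 m3] //=.
by move=> [s1] [s2] [s3]; rewrite IHx.
Qed.

Definition kept_count (m : seq bool) : nat := count id m.

Fixpoint piece_products (R : realFieldType) (lam : R) (ls : seq nat)
    (m m' : seq bool) : R :=
  if ls is l :: ls' then
    ((kept_count (take l m))%:R - lam) * ((kept_count (take l m'))%:R - lam) +
    piece_products lam ls' (drop l m) (drop l m')
  else 0.

Lemma seen_products_annotate (R : realFieldType) (lam : R) b x m1 m2 m3 :
  size m1 = size x -> size m2 = size x -> size m3 = size x ->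
  seen_products lam b 0 0 (annotate x m1 m2 m3) =
  piece_products lam (pieces b x m1) m2 m3.
Proof.
move=> s1 s2 s3.
(* The induction needs arbitrary counts [p] and [q] already collected in the open piece. *)
suff H p q l ls : pieces b x m1 = l :: ls ->
    seen_products lam b p q (annotate x m1 m2 m3) =
    ((p + kept_count (take l m2))%:R - lam) * ((q + kept_count (take l m3))%:R - lam)
    + piece_products lam ls (drop l m2) (drop l m3).
  by have [l [ls e]] := pieces_cons b x m1; rewrite (H 0%N 0%N _ _ e) e.
rewrite /annotate; elim: x b m1 m2 m3 s1 s2 s3 p q l ls =>
  [|c x IHx] b [|k1 m1] [|k2 m2] [|k3 m3] //= s1 s2 s3 p q l ls.
  by case=> _ <-; rewrite /= !addn0 addr0.
move: s1 s2 s3 => [s1] [s2] [s3]; move: (if k1 then c else b) => b'.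
have [l' [ls' e]] := pieces_cons b' x m1.
rewrite e; case: eqVneq => _ /= [<- <-].
  by rewrite /= (IHx _ _ _ _ s1 s2 s3 _ _ _ _ e) !addnA.
by rewrite /= !addn0 (IHx _ _ _ _ s1 s2 s3 _ _ _ _ e).
Qed.

(** * Moments given the first sample *)

Lemma mask_mean_sqrD (R : realFieldType) (r : R) N a F :
  mask_mean r N (fun m => (a + F m) ^+ 2) =
  a ^+ 2 + 2 * a * mask_mean r N F + mask_mean r N (fun m => F m ^+ 2).
Proof.
under eq_mask_mean => m _ do rewrite sqrrD.
rewrite !mask_meanD mask_mean_cst; congr (_ + _ + _).
by rewrite mask_meanZ; ring.
Qed.

(** Given the first sample, each error is hit independently with probability [r]. The centred form
    makes the cross term vanish in the variance below. *)
Lemma mean_hits (R : realFieldType) (r : R) b x m : size m = size x ->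
  mask_mean r (size x) (fun m' => (hits b x m m')%:R - r * (errors b x m)%:R) = 0.
Proof.
elim: x b m => [|c x IHx] b [|k m] //=; first by rewrite mulr0 subr0.
move=> [/IHx IH]; move: (if k then c else b) => b'.
under eq_mask_mean => m' _.
  rewrite (_ : _ - _ = ((c != b')%:R * (1 - r)) +
    ((hits b' x m m')%:R - r * (errors b' x m)%:R)); last by rewrite !natrD; ring.
  over.
rewrite mask_meanD mask_mean_cst IH.
under eq_mask_mean => m' _.
  rewrite (_ : _ - _ = - ((c != b')%:R * r) +
    ((hits b' x m m')%:R - r * (errors b' x m)%:R)); last by rewrite !natrD; ring.
  over.
by rewrite mask_meanD mask_mean_cst IH; ring.
Qed.

Lemma var_hits (R : realFieldType) (r : R) b x m : size m = size x ->
  mask_mean r (size x)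
    (fun m' => ((hits b x m m')%:R - r * (errors b x m)%:R) ^+ 2) =
  r * (1 - r) * (errors b x m)%:R.
Proof.
elim: x b m => [|c x IHx] b [|k m] //=; first by rewrite !mulr0 subr0 expr0n.
move=> [sm]; move: (if k then c else b) => b'.
under eq_mask_mean => m' _.
  rewrite (_ : _ - _ = ((c != b')%:R * (1 - r)) +
    ((hits b' x m m')%:R - r * (errors b' x m)%:R)); last by rewrite !natrD; ring.
  over.
rewrite mask_mean_sqrD mean_hits // IHx //.
under eq_mask_mean => m' _.
  rewrite (_ : _ - _ = - ((c != b')%:R * r) +
    ((hits b' x m m')%:R - r * (errors b' x m)%:R)); last by rewrite !natrD; ring.
  over.
rewrite mask_mean_sqrD mean_hits // IHx //.
by rewrite natrD; case: (c != b') => /=; ring.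
Qed.

(** The shift [a] is left free because keeping the first symbol replaces it by [a - 1]. *)
Lemma mean_kept_count (R : realFieldType) (r a : R) N :
  mask_mean r N (fun m => (kept_count m)%:R - a) = r * N%:R - a.
Proof.
elim: N a => [|N IHN] a /=; first by rewrite mulr0.
under eq_mask_mean => m _.
  rewrite (_ : _ - _ = (kept_count m)%:R - (a - 1)); last by rewrite /kept_count /= natrD; ring.
  over.
by rewrite !IHN -natr1; ring.
Qed.

Lemma var_kept_count (R : realFieldType) (r a : R) N :
  mask_mean r N (fun m => ((kept_count m)%:R - a) ^+ 2) =
  r * (1 - r) * N%:R + (r * N%:R - a) ^+ 2.
Proof.
elim: N a => [|N IHN] a /=; first by rewrite !mulr0 !add0r.
under eq_mask_mean => m _.
  rewrite (_ : _ - _ = (kept_count m)%:R - (a - 1)); last by rewrite /kept_count /= natrD; ring.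
  over.
by rewrite !IHN -natr1; ring.
Qed.

Definition mask_mean2 (R : realFieldType) (r : R) N (F : seq bool -> seq bool -> R) : R :=
  mask_mean r N (fun m => mask_mean r N (F m)).

Lemma mask_mean2_cat (R : realFieldType) (r : R) N1 N2 F :
  mask_mean2 r (N1 + N2) F =
  mask_mean2 r N1 (fun m m' => mask_mean2 r N2 (fun p p' => F (m ++ p) (m' ++ p'))).
Proof.
rewrite /mask_mean2 mask_mean_cat; apply: eq_mask_mean => m _.
rewrite [RHS]mask_mean_swap; apply: eq_mask_mean => p _.
by rewrite mask_mean_cat.
Qed.

Lemma eq_mask_mean2 (R : realFieldType) (r : R) N F G :
  (forall m m', size m = N -> size m' = N -> F m m' = G m m') ->
  mask_mean2 r N F = mask_mean2 r N G.
Proof. by move=> FG; apply: eq_mask_mean => m sm; apply: eq_mask_mean => m' sm'; exact: FG. Qed.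

Lemma le_mask_mean2 (R : realFieldType) (r : R) N F G : 0 <= r <= 1 ->
  (forall m m', size m = N -> size m' = N -> F m m' <= G m m') ->
  mask_mean2 r N F <= mask_mean2 r N G.
Proof. by move=> r01 FG; apply: le_mask_mean => // m sm; apply: le_mask_mean => // m' sm'; exact: FG. Qed.

Lemma mask_mean2_lin (R : realFieldType) (r : R) N a b F G :
  mask_mean2 r N (fun m m' => a * F m m' + b * G m m') =
  a * mask_mean2 r N F + b * mask_mean2 r N G.
Proof. exact: mask_mean_lin2. Qed.

Lemma mask_mean2_cst (R : realFieldType) (r : R) N a :
  mask_mean2 r N (fun _ _ => a) = a.
Proof. by rewrite /mask_mean2 !mask_mean_cst. Qed.

Lemma mask_mean2M (R : realFieldType) (r : R) N F G :
  mask_mean2 r N (fun m m' => F m * G m') = mask_mean r N F * mask_mean r N G.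
Proof.
rewrite /mask_mean2; under eq_mask_mean => m _ do rewrite mask_meanZ mulrC.
by rewrite mask_meanZ mulrC.
Qed.

Definition piece_bias (R : realFieldType) (r lam : R) (ls : seq nat) : R :=
  \sum_(l <- ls) (r * l%:R - lam) ^+ 2.

(** The two counts in a piece are independent with the same mean, so their centred product is an
    unbiased estimate of [(r l - lam)^2], with no variance term as a single squared count would
    have. *)
Lemma mean_piece_products (R : realFieldType) (r lam : R) ls :
  mask_mean2 r (sumn ls) (fun m m' => piece_products lam ls m m') =
  piece_bias r lam ls.
Proof.
elim: ls => [|l ls IHls]; rewrite /piece_bias ?big_nil ?big_cons /=.
  by rewrite mask_mean2_cst.
rewrite mask_mean2_cat.
under eq_mask_mean2 => m m' sm sm'.
  under eq_mask_mean2 => p p' _ _.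
    rewrite !take_size_cat // !drop_size_cat // -[X in X + _]mul1r -[X in _ + X]mul1r.
    over.
  rewrite mask_mean2_lin mask_mean2_cst IHls -[X in _ + X]mul1r.
  over.
by rewrite mask_mean2_lin mask_mean2_cst mask_mean2M !mean_kept_count -expr2 !mul1r.
Qed.

(** Pieces are disjoint, hence independent, and a product of independent factors has variance
    [E X^2 E Y^2 - (E X E Y)^2]. *)
Lemma var_piece_products (R : realFieldType) (r lam : R) ls :
  mask_mean2 r (sumn ls)
    (fun m m' => (piece_products lam ls m m' - piece_bias r lam ls) ^+ 2) =
  \sum_(l <- ls) ((r * (1 - r) * l%:R + (r * l%:R - lam) ^+ 2) ^+ 2 -
     (r * l%:R - lam) ^+ 4).
Proof.
elim: ls => [|l ls IHls]; rewrite /piece_bias ?big_nil ?big_cons /=.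
  by rewrite subr0 expr0n mask_mean2_cst.
rewrite mask_mean2_cat.
set V := \sum_(l <- ls) _ in IHls *; set d := r * l%:R - lam.
pose X m m' : R := ((kept_count m)%:R - lam) * ((kept_count m')%:R - lam).
under eq_mask_mean2 => m m' sm sm'.
  under eq_mask_mean2 => p p' _ _.
    rewrite !take_size_cat // !drop_size_cat //.
    (* The square is split so that only the variance and the mean of the remaining pieces enter. *)
    rewrite (_ : _ ^+ 2 = 1 * (piece_products lam ls p p' - piece_bias r lam ls) ^+ 2 +
       1 * (2 * (X m m' - d ^+ 2) * piece_products lam ls p p' +
         (X m m' - d ^+ 2) * (X m m' - d ^+ 2 - 2 * piece_bias r lam ls))); last first.
      by rewrite /X /piece_bias; ring.
    over.
  rewrite !mask_mean2_lin IHls mask_mean2_cst mean_piece_products.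
  rewrite (_ : 1 * V + _ = 1 * (((kept_count m)%:R - lam) ^+ 2 * ((kept_count m')%:R - lam) ^+ 2)
    + 1 * (- 2 * d ^+ 2 * X m m' + 1 * (d ^+ 4 + V))); last by rewrite /X; ring.
  over.
rewrite !mask_mean2_lin mask_mean2_cst /X !mask_mean2M !mean_kept_count !var_kept_count -/d.
by ring.
Qed.

(** * Uniform strings *)

(* A position that disagrees with the current label is a change if it is sampled
   and an error otherwise. *)
Lemma mean_errors (R : realFieldType) (r : R) b x :
  r * mask_mean r (size x) (fun m => (errors b x m)%:R) =
  (1 - r) * mask_mean r (size x) (fun m => (changes b x m)%:R).
Proof.
elim: x b => [|c x IHx] b /=; first by rewrite !mulr0.
under eq_mask_mean => m _ do rewrite natrD.
under [X in (1 - r) * X]eq_mask_mean => m _ do rewrite natrD.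
under [X in _ = _ * (_ * X + _)]eq_mask_mean => m _ do rewrite natrD.
under [X in _ = _ * (_ + _ * X)]eq_mask_mean => m _ do rewrite natrD.
rewrite !mask_meanD !mask_mean_cst !eqxx /=.
transitivity (r * (1 - r) * (c != b)%:R +
    r * (r * mask_mean r (size x) (fun m => (errors c x m)%:R)) +
    (1 - r) * (r * mask_mean r (size x) (fun m => (errors b x m)%:R))).
  ring.
by rewrite !IHx; ring.
Qed.

(** [u + L] is the length already accumulated by the first piece.  Subtracting
    [L ^+ 2] per piece makes the total plus [n L^2] equal to the sum of
    [(l_i - L)^2] padded to [n] pieces. *)
Definition pieces_excess (R : realFieldType) (L u : R) (ls : seq nat) : R :=
  (u + (head 0%N ls)%:R) ^+ 2 - L ^+ 2 +
  \sum_(l <- behead ls) ((l%:R - L) ^+ 2 - L ^+ 2).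

Definition mean_excess (R : realFieldType) (r L : R) (b : bool) (u : R) (x : seq bool) : R :=
  mask_mean r (size x) (fun m => pieces_excess L u (pieces b x m)).

Lemma mean_excess_nil (R : realFieldType) (r L : R) b u :
  mean_excess r L b u [::] = u ^+ 2 - L ^+ 2.
Proof. by rewrite /mean_excess /pieces_excess /= addr0 big_nil addr0. Qed.

Lemma mean_excess_same (R : realFieldType) (r L : R) b u x :
  mean_excess r L b u (b :: x) = mean_excess r L b (u + 1) x.
Proof.
rewrite /mean_excess /= eqxx -mulrDl addrC subrK mul1r.
apply: eq_mask_mean => m _; have [l [ls ->]] := pieces_cons b x m.
by rewrite /pieces_excess /= -natr1 [_ + 1]addrC addrA.
Qed.

Lemma mean_excess_other (R : realFieldType) (r L : R) b u x :
  mean_excess r L b u (~~ b :: x) =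
  r * (u ^+ 2 - L ^+ 2 + mean_excess r L (~~ b) (1 - L) x) +
  (1 - r) * mean_excess r L b (u + 1) x.
Proof.
rewrite /mean_excess /= eqxx (_ : (~~ b != b) = true); last by case: b.
congr (_ * _ + _ * _).
  rewrite -(mask_mean_cst r (size x) (u ^+ 2 - L ^+ 2)) -mask_meanD.
  apply: eq_mask_mean => m _; have [l [ls ->]] := pieces_cons (~~ b) x m.
  by rewrite /pieces_excess /= big_cons -natr1; ring.
apply: eq_mask_mean => m _; have [l [ls ->]] := pieces_cons b x m.
by rewrite /pieces_excess /= -natr1 [_ + 1]addrC addrA.
Qed.

Lemma mean_excess_nseq (R : realFieldType) (r L : R) b u l x :
  mean_excess r L b u (nseq l b ++ x) = mean_excess r L b (u + l%:R) x.
Proof.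
elim: l u => [|l IHl] u /=; first by rewrite addr0.
by rewrite mean_excess_same IHl -natr1; congr mean_excess; ring.
Qed.

(* [E (v + G)^2] for [G] geometric, i.e. [P (G = g) = r (1 - r)^g]. *)
Definition geom_sqr (R : realFieldType) (r v : R) : R :=
  v ^+ 2 + 2 * v * ((1 - r) / r) + ((1 - r) + (1 - r) ^+ 2) / r ^+ 2.

(** First-step analysis: [G] is zero with probability [r] and otherwise one more than a fresh
    copy. *)
Lemma geom_sqrE (R : realFieldType) (r v : R) : r != 0 ->
  r * v ^+ 2 + (1 - r) * geom_sqr r (v + 1) = geom_sqr r v.
Proof. by move=> r0; rewrite /geom_sqr; field. Qed.

Lemma geom_sqr_ge0 (R : realFieldType) (r v : R) : 0 < r < 1 -> 0 <= geom_sqr r v.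
Proof.
move=> /andP[r0 r1].
have -> : geom_sqr r v = (v + (1 - r) / r) ^+ 2 + (1 - r) / r ^+ 2.
  by rewrite /geom_sqr; field; rewrite gt_eqF.
by rewrite addr_ge0 ?sqr_ge0 // divr_ge0 ?sqr_ge0 // subr_ge0 ltW.
Qed.

(** Let [G] be the geometric number of unsampled symbols before the first sampled one. If [G < j],
    the open piece closes at [v + G] and the new one starts with [j - G] symbols of the block, a
    case bounded by the first hypothesis. With probability [(1 - r)^j] the block is missed, which
    costs [T]. Letting [G] range beyond [j] only adds nonnegative terms. *)
Lemma mean_excess_block (R : realFieldType) (r L A T v : R) b j x :
  0 < r < 1 ->
  (forall i, (i <= j)%N ->
    mean_excess r L b (i%:R - L) x <= 3 * (i%:R - L) ^+ 2 + A) ->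
  mean_excess r L (~~ b) (v + j%:R) x <= T + A - L ^+ 2 ->
  mean_excess r L (~~ b) v (nseq j b ++ x) <=
    geom_sqr r v + 3 * geom_sqr r (L - j%:R) + A - L ^+ 2 + (1 - r) ^+ j * T.
Proof.
move=> r01; have /andP[r0 r1] := r01.
elim: j v => [|j IHj] v hA hT /=.
  rewrite addr0 in hT; rewrite expr0 mul1r.
  by have := geom_sqr_ge0 v r01; have := geom_sqr_ge0 (L - 0%:R) r01; lra.
have := @mean_excess_other R r L (~~ b) v (nseq j b ++ x); rewrite negbK => ->.
rewrite mean_excess_nseq.
have h1 := hA j.+1 (leqnn _).
have h2 : mean_excess r L (~~ b) (v + 1) (nseq j b ++ x) <=
    geom_sqr r (v + 1) + 3 * geom_sqr r (L - j%:R) + A - L ^+ 2 + (1 - r) ^+ j * T.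
  apply: IHj => [i ij|]; first by apply: hA; exact: leqW.
  by rewrite -addrA [1 + _]addrC natr1.
have e1 := geom_sqrE v (lt0r_neq0 r0).
have e2 := geom_sqrE (L - j.+1%:R) (lt0r_neq0 r0).
have e3 : L - j.+1%:R + 1 = L - j%:R by rewrite -natr1; ring.
rewrite e3 in e2.
have e4 : 1 - L + j%:R = j.+1%:R - L by rewrite -natr1; ring.
rewrite e4 [(1 - r) ^+ j.+1]exprS.
have := ler_wpM2l (ltW r0) h1; have q0 : 0 <= 1 - r by lra.
have := ler_wpM2l q0 h2.
rewrite -e1 -e2; set g1 := geom_sqr _ _; set g2 := geom_sqr _ _.
set M1 := mean_excess _ _ _ _ _; set M2 := mean_excess _ _ _ _ _.
set p := (1 - r) ^+ j. lra.
Qed.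

(* Two-step induction with the potential [3 u^2]: with probability [(1 - r)^L] a
   block is missed altogether, and then the next block continues the piece. *)
Lemma mean_excess_blocks (R : realFieldType) (r u : R) b L k :
  0 < r < 1 -> (1 - r) ^+ L <= 1 / 6 -> (1 - r) ^+ L * L%:R ^+ 2 <= 2 / r ^+ 2 ->
  - L%:R <= u ->
  mean_excess r L%:R (~~ b) u (blocks b (nseq k L)) <=
    3 * u ^+ 2 + k%:R * (61 / r ^+ 2) - k.+1%:R * L%:R ^+ 2.
Proof.
move=> r01 q6 qL; have /andP[r0 r1] := r01.
elim/ltn_ind: k b u => -[|k] IHk b u uL.
  by rewrite /= mean_excess_nil; nra.
have r2 : 0 < r ^+ 2 by rewrite exprn_gt0.
(* [T] covers a missed block: the open piece then also absorbs the following block, if any, and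
   [2 L^2] makes up for the two blocks that open no piece of their own. *)
pose T := 3 * (u + 2 * L%:R) ^+ 2 + 2 * L%:R ^+ 2.
pose A := k%:R * (61 / r ^+ 2) - k.+1%:R * L%:R ^+ 2.
have B0 : 0 <= 61 / r ^+ 2 by rewrite divr_ge0 ?ltW.
have hT : mean_excess r L%:R (~~ b) (u + L%:R) (blocks (~~ b) (nseq k L)) <= T + A - L%:R ^+ 2.
  case: k IHk @A => [|k] IHk A.
    rewrite /= mean_excess_nil /T /A; have := ler0n R L.
    by nra.
  rewrite [blocks _ _]/= mean_excess_nseq.
  have := IHk k (leqW (leqnn _)) (~~ ~~ b) (u + L%:R + L%:R); rewrite negbK.
  have L0 := ler0n R L.
  move=> /(_ ltac:(lra)) h; apply: le_trans h _.
  rewrite /T /A -!natr1.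
  by nra.
have hA i : (i <= L)%N ->
    mean_excess r L%:R b (i%:R - L%:R) (blocks (~~ b) (nseq k L)) <= 3 * (i%:R - L%:R) ^+ 2 + A.
  move=> iL; have := IHk k (leqnn _) (~~ b) (i%:R - L%:R); rewrite negbK.
  have := ler0n R i => i0.
  by move=> /(_ ltac:(lra)); rewrite /A addrA.
rewrite [blocks _ _]/=; apply: le_trans (mean_excess_block r01 hA hT) _.
rewrite subrr.
(* The bounds below contribute [3 * 2 + 3 + 52 = 61] to the coefficient of [1 / r^2] and [2 + 1 = 3]
   to that of [u^2]. *)
have g0 : geom_sqr r 0 <= 2 / r ^+ 2.
  rewrite /geom_sqr expr0n mulr0 mul0r !add0r ler_pM2r ?invr_gt0 //; nra.
have gu : geom_sqr r u <= 2 * u ^+ 2 + 3 / r ^+ 2.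
  have -> : geom_sqr r u = 2 * u ^+ 2 - (u - (1 - r) / r) ^+ 2 + ((1 - r) + 2 * (1 - r) ^+ 2) / r ^+ 2.
    by rewrite /geom_sqr; field; rewrite gt_eqF.
  have : ((1 - r) + 2 * (1 - r) ^+ 2) / r ^+ 2 <= 3 / r ^+ 2.
    by rewrite ler_pM2r ?invr_gt0 //; nra.
  by have := sqr_ge0 (u - (1 - r) / r); lra.
have q0 : 0 <= (1 - r) ^+ L by rewrite exprn_ge0 // subr_ge0 ltW.
have hq : (1 - r) ^+ L * T <= u ^+ 2 + 52 / r ^+ 2.
  have : T <= 6 * u ^+ 2 + 26 * L%:R ^+ 2.
    by rewrite /T; have := sqr_ge0 (u - 2 * L%:R); nra.
  move=> /(ler_wpM2l q0) h; apply: le_trans h _.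
  have := ler_wpM2r (sqr_ge0 u) q6; rewrite mulrDr.
  move: qL; rewrite -!mulrA; lra.
rewrite /A -!natr1; lra.
Qed.

(** * Acceptance *)

(** The mean of [Z] given the first sample; every missing piece counts as one of length zero, with
    deviation [lam]. *)
Definition bias (R : realFieldType) (r lam : R) (n : nat) (ls : seq nat) : R :=
  piece_bias r lam ls + (n%:R - (size ls)%:R) * lam ^+ 2.

Lemma piece_bias_ge0 (R : realFieldType) (r lam : R) ls : 0 <= piece_bias r lam ls.
Proof. by apply: sumr_ge0 => l _; exact: sqr_ge0. Qed.

Lemma piece_bias_le (R : realFieldType) (r lam : R) n ls : (size ls <= n)%N ->
  piece_bias r lam ls <= bias r lam n ls.
Proof. by move=> sn; rewrite lerDl mulr_ge0 ?sqr_ge0 // subr_ge0 ler_nat. Qed.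

Lemma sum_pow4_le (R : realFieldType) (I : Type) (s : seq I) (f : I -> R) :
  \sum_(i <- s) f i ^+ 4 <= (\sum_(i <- s) f i ^+ 2) ^+ 2.
Proof.
elim: s => [|i s IHs]; first by rewrite !big_nil expr0n.
rewrite !big_cons sqrrD -exprM -addrA lerD2l.
apply: (le_trans IHs); rewrite lerDr mulrn_wge0 // mulr_ge0 ?sqr_ge0 //.
by apply: sumr_ge0 => j _; exact: sqr_ge0.
Qed.

Lemma var_piece_products_le (R : realFieldType) (r lam : R) n ls :
  0 < r < 1 -> 0 < lam -> (size ls <= n)%N ->
  mask_mean2 r (sumn ls)
    (fun m m' => (piece_products lam ls m m' - piece_bias r lam ls) ^+ 2) <=
  2 * n%:R * lam ^+ 2 + 2 * bias r lam n ls + 3 * lam * bias r lam n ls +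
  bias r lam n ls ^+ 2 / lam.
Proof.
move=> /andP[r0 r1] lam0 sn; rewrite var_piece_products.
have := piece_bias_le r lam sn; have := piece_bias_ge0 r lam ls.
set S := piece_bias r lam ls; set M := bias _ _ _ _ => S0 SM.
apply: (@le_trans _ _ (\sum_(l <- ls) (2 * lam ^+ 2 + (2 + 3 * lam) * (r * l%:R - lam) ^+ 2 +
    lam^-1 * (r * l%:R - lam) ^+ 4))).
  apply: ler_sum => l _; set d := r * l%:R - lam.
  have -> : r * (1 - r) * l%:R = (1 - r) * (d + lam) by rewrite /d; ring.
  have d0 : 0 <= d + lam by rewrite /d subrK mulr_ge0 ?ler0n ?(ltW r0).
  have h1 : ((1 - r) * (d + lam) + d ^+ 2) ^+ 2 - d ^+ 4 <= (d + lam) ^+ 2 + 2 * (d + lam) * d ^+ 2.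
    have a0 : 0 <= (1 - r) * (d + lam) <= d + lam.
      by rewrite mulr_ge0 ?subr_ge0 ?(ltW r1) //= ler_piMl //; lra.
    move: a0; set a := (1 - r) * _ => /andP[a0 a1].
    have := sqr_ge0 d; nra.
  (* AM-GM replaces the odd power of [d], whose sign is unknown, by even ones. *)
  have h2 : 2 * d ^+ 3 <= lam * d ^+ 2 + lam^-1 * d ^+ 4.
    have -> : lam * d ^+ 2 + lam^-1 * d ^+ 4 = 2 * d ^+ 3 + lam^-1 * (lam * d - d ^+ 2) ^+ 2.
      by field; rewrite gt_eqF.
    by rewrite lerDl mulr_ge0 ?sqr_ge0 // invr_ge0 ltW.
  by have := sqr_ge0 (d - lam); lra.
rewrite !big_split /=.
have h3 : \sum_(l <- ls) lam^-1 * (r * l%:R - lam) ^+ 4 <= M ^+ 2 / lam.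
  rewrite -mulr_sumr mulrC ler_pM2r ?invr_gt0 //.
  by apply: (le_trans (sum_pow4_le _ _)); rewrite -/(piece_bias r lam ls) -/S; nra.
have h4 : \sum_(l <- ls) (2 * lam ^+ 2) <= 2 * n%:R * lam ^+ 2.
  rewrite big_const_seq count_predT iter_addr addr0 -mulr_natr.
  have : (size ls)%:R <= n%:R :> R by rewrite ler_nat.
  by move/(ler_wpM2l (sqr_ge0 lam)); lra.
have h6 : \sum_(l <- ls) (2 + 3 * lam) * (r * l%:R - lam) ^+ 2 <= (2 + 3 * lam) * M.
  by rewrite -mulr_sumr -/(piece_bias r lam ls) -/S ler_pM2l //; lra.
lra.
Qed.

Lemma mean_bias_uniform (R : realFieldType) (r : R) b L n :
  0 < r < 1 -> (0 < n)%N ->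
  (1 - r) ^+ L <= 1 / 6 -> (1 - r) ^+ L * L%:R ^+ 2 <= 2 / r ^+ 2 ->
  mask_mean r (size (blocks b (nseq n L)))
    (fun m => bias r (r * L%:R) n (pieces b (blocks b (nseq n L)) m)) <= 61 * n%:R.
Proof.
move=> r01 n0 q6 qL; set x := blocks _ _; have /andP[r0 r1] := r01.
(* Starting at [u = - L] gives the first piece the same deviation from [L] as the others. *)
rewrite (@eq_mask_mean _ _ _ _ (fun m => r ^+ 2 * pieces_excess L%:R (- L%:R) (pieces b x m) +
   n%:R * (r * L%:R) ^+ 2 * 1)); last first.
  move=> m _; have [l [ls ->]] := pieces_cons b x m.
  rewrite /bias /piece_bias /pieces_excess big_cons /= [- _ + _]addrC mulrDr mulr_sumr.
  have -> : \sum_(j <- ls) r ^+ 2 * ((j%:R - L%:R) ^+ 2 - L%:R ^+ 2) =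
      \sum_(j <- ls) (r * j%:R - r * L%:R) ^+ 2 - (size ls)%:R * (r * L%:R) ^+ 2.
    elim: ls => [|j ls IHls]; first by rewrite !big_nil mul0r subr0.
    by rewrite !big_cons IHls /= -natr1; ring.
  by rewrite -natr1; ring.
rewrite mask_mean_lin mask_mean_cst -/(mean_excess r L%:R b (- L%:R) x).
(* The initial guess is right, so the first block only raises [u] from [- L] to zero and the term
   [3 u^2] disappears. *)
case: n n0 @x => // n _ x; rewrite /x [blocks _ _]/= mean_excess_nseq addNr.
have := @mean_excess_blocks _ r 0 (~~ b) L n r01 q6 qL; rewrite negbK oppr_le0 ler0n => /(_ isT).
rewrite expr0n mulr0 add0r => /(ler_wpM2l (sqr_ge0 r)).
have -> : r ^+ 2 * (n%:R * (61 / r ^+ 2) - n.+1%:R * L%:R ^+ 2) = 61 * n%:R - n.+1%:R * (r * L%:R) ^+ 2.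
  by field; rewrite gt_eqF.
by rewrite mulr1 -!natr1; lra.
Qed.

Definition accepts (R : realFieldType) (lam tau : R) (n : nat) (b : bool)
    (l : seq (bool * colour)) : bool :=
  [&& (seen_changes b l < n)%N, (seen_errors b l <= 24 * n)%N &
    seen_products lam b 0 0 l + (n%:R - (seen_changes b l).+1%:R) * lam ^+ 2 <= tau].

Lemma accepts_kept (R : realFieldType) (lam tau : R) n b l :
  accepts lam tau n b [seq e <- l | kept e] = accepts lam tau n b l.
Proof. by rewrite /accepts seen_changes_kept seen_errors_kept seen_products_kept. Qed.

Lemma accepts_annotate (R : realFieldType) (r lam tau : R) n b x m1 m2 m3 :
  size m1 = size x -> size m2 = size x -> size m3 = size x ->
  let ls := pieces b x m1 in
  accepts lam tau n b (annotate x m1 m2 m3) =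
  [&& (changes b x m1 < n)%N, (hits b x m1 m2 <= 24 * n)%N &
    piece_products lam ls m2 m3 - piece_bias r lam ls <= tau - bias r lam n ls].
Proof.
move=> s1 s2 s3 ls; rewrite /accepts seen_changes_annotate // seen_errors_annotate //.
rewrite seen_products_annotate // /bias size_pieces -/ls.
by congr [&& _, _ & _]; apply/idP/idP => ?; lra.
Qed.

(** * Tail bounds and error probabilities *)

Lemma mean_chebyshev (R : realFieldType) (r v t : R) N (F : seq bool -> seq bool -> R)
    (P : seq bool -> seq bool -> bool) : 0 <= r <= 1 -> 0 < t ->
  mask_mean2 r N (fun m m' => F m m' ^+ 2) <= v ->
  (forall m m', size m = N -> size m' = N -> P m m' -> t ^+ 2 <= F m m' ^+ 2) ->
  mask_mean2 r N (fun m m' => (P m m')%:R) <= v / t ^+ 2.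
Proof.
move=> r01 t0 Fv PF; have t2 : 0 < t ^+ 2 by rewrite exprn_gt0.
rewrite ler_pdivlMr // mulrC; apply: le_trans Fv.
rewrite -[X in X <= _]addr0 -[X in _ + X](mul0r (mask_mean2 r N (fun _ _ => 0))) -mask_mean2_lin.
apply: le_mask_mean2 => // m m' sm sm'; rewrite mulr0 addr0.
by case: (boolP (P m m')) => [/PF|_]; rewrite ?mulr1 ?mulr0 ?sqr_ge0 //; apply.
Qed.

Lemma le1_mask_mean2 (R : realFieldType) (r : R) N (P : seq bool -> seq bool -> bool) :
  0 <= r <= 1 -> mask_mean2 r N (fun m m' => (P m m')%:R) <= 1.
Proof.
move=> r01; rewrite -[leRHS](mask_mean2_cst r N); apply: le_mask_mean2 => // m m' _ _.
by rewrite lern1 leq_b1.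
Qed.

Lemma mean_hits_gt (R : realFieldType) (r a : R) b x m :
  0 <= r <= 1 -> 0 < a -> size m = size x ->
  mask_mean r (size x) (fun m' => (a < (hits b x m m')%:R)%R%:R) <=
  r * (errors b x m)%:R / a.
Proof.
move=> r01 a0 sm.
have -> : r * (errors b x m)%:R / a =
    mask_mean r (size x) (fun m' => a^-1 * (hits b x m m')%:R).
  rewrite mask_meanZ mulrC; congr (_ * _).
  have := mean_hits r b sm.
  under eq_mask_mean => m' _ do rewrite -[_ - _]addrC.
  by rewrite mask_meanD mask_mean_cst => /eqP; rewrite addrC subr_eq0 => /eqP.
apply: le_mask_mean => // m' _; case: ltP => h /=.
  by rewrite mulrC ler_pdivlMr // mul1r ltW.
by rewrite mulr_ge0 ?invr_ge0 ?(ltW a0).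
Qed.

(** The mean [mu] of the hits is at least [2 a], so the event is a deviation of at least [mu / 2],
    while the variance is at most [mu]. *)
Lemma mean_hits_le (R : realFieldType) (r a : R) b x m :
  0 <= r <= 1 -> 0 < a -> 2 * a <= r * (errors b x m)%:R -> size m = size x ->
  mask_mean r (size x) (fun m' => ((hits b x m m')%:R <= a)%R%:R) <=
  4 / (r * (errors b x m)%:R).
Proof.
move=> r01 a0 ea sm; have /andP[r0 r1] := r01.
move: ea (var_hits r b sm); set mu := r * _ => ea var.
have mu0 : 0 < mu by lra.
have t0 : 0 < mu / 2 by lra.
have -> : mask_mean r (size x) (fun m' => ((hits b x m m')%:R <= a)%R%:R) =
    mask_mean2 r (size x) (fun m' _ => ((hits b x m m')%:R <= a)%R%:R).
  by apply: eq_mask_mean => m' _; rewrite mask_mean_cst.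
have -> : 4 / mu = mu / (mu / 2) ^+ 2 by field; rewrite gt_eqF.
apply: (@mean_chebyshev _ _ _ _ _ (fun m' _ => (hits b x m m')%:R - mu)) => //.
  rewrite /mask_mean2; under eq_mask_mean => m' _ do rewrite mask_mean_cst.
  rewrite var mulrAC -/mu ler_piMr ?(ltW mu0) //; lra.
move=> m' _ _ _ h; rewrite -subr_ge0.
have -> : ((hits b x m m')%:R - mu) ^+ 2 - (mu / 2) ^+ 2 =
  (mu / 2 - (hits b x m m')%:R) * (mu * (3 / 2) - (hits b x m m')%:R) by field.
by apply: mulr_ge0; lra.
Qed.

(* Chebyshev if the bias is at most four times the bound [61 n] on its mean for
   uniform strings, and Markov otherwise. *)
Lemma mean_product_gt (R : realFieldType) (r lam t : R) n ls :
  0 < r < 1 -> (40 * 120) <= lam -> 1 <= t -> t ^+ 2 = n%:R -> (size ls <= n)%N ->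
  mask_mean2 r (sumn ls) (fun m m' =>
    (3 * 100 * (n%:R + t * lam) - bias r lam n ls <
      piece_products lam ls m m' - piece_bias r lam ls)%R%:R) <=
  bias r lam n ls / ((4 * 61) * n%:R) + 1 / 24.
Proof.
move=> r01 lam1 t1 tn sn; have /andP[r0 r1] := r01.
have r01' : 0 <= r <= 1 by rewrite !ltW.
have n1 : 1 <= n%:R :> R by rewrite -tn expr_ge1 //; lra.
have M0 : 0 <= bias r lam n ls by apply: le_trans (piece_bias_ge0 r lam ls) (piece_bias_le _ _ sn).
have lam0 : 0 < lam by lra.
have := var_piece_products_le r01 lam0 sn.
move: M0; set M := bias _ _ _ _ => M0 var.
have [MN|NM] := leP ((4 * 61) * n%:R) M.
  apply: (le_trans (le1_mask_mean2 _ _ r01')).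
  rewrite -[1 in leLHS]addr0; apply: lerD; last lra.
  by rewrite ler_pdivlMr ?mul1r //; lra.
have tl0 : 0 <= t * lam by rewrite mulr_ge0 //; lra.
set T := 3 * 100 * _ - M.
(* Here the bias is below [244 n], and [300 - 244 = 56]. *)
have T1 : 56 * (n%:R + t * lam) <= T by rewrite /T; lra.
have T0 : 0 < T by apply: lt_le_trans T1; lra.
apply: (le_trans (mean_chebyshev r01' T0 var _)) => [m m' _ _ h|].
  by rewrite ler_sqr ?nnegrE ?ltW // (lt_trans T0).
apply: ler_wpDl; first by rewrite divr_ge0 // mulr_ge0.
rewrite ler_pdivrMr ?exprn_gt0 //.
apply: (@le_trans _ _ (1 / 24 * (56 ^+ 2 * (n%:R ^+ 2 + n%:R * lam ^+ 2)))); last first.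
  rewrite ler_pM2l; last lra.
  have -> : n%:R * lam ^+ 2 = (t * lam) ^+ 2 by rewrite -tn; ring.
  have : 0 <= n%:R * (t * lam) by rewrite mulr_ge0.
  have : (56 * (n%:R + t * lam)) ^+ 2 <= T ^+ 2.
    by rewrite ler_sqr ?nnegrE ?(ltW T0) // mulr_ge0 // addr_ge0.
  lra.
have h1 : M ^+ 2 / lam <= (4 * 61) ^+ 2 / (40 * 120) * n%:R ^+ 2.
  rewrite ler_pdivrMr //.
  have : M ^+ 2 <= ((4 * 61) * n%:R) ^+ 2.
    by rewrite ler_sqr ?nnegrE ?mulr_ge0 //; exact: ltW.
  have : 0 <= n%:R ^+ 2 * (lam - (40 * 120)) by rewrite mulr_ge0 ?sqr_ge0 //; lra.
  lra.
have h2 : lam * M <= (4 * 61) * n%:R * lam by rewrite mulrC ler_pM2r // ltW.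
have h3 : n%:R * lam * (40 * 120) <= n%:R * lam ^+ 2.
  have : 0 <= n%:R * lam * (lam - 40 * 120) by rewrite !mulr_ge0 ?(ltW lam0) //; lra.
  lra.
have h4 : n%:R * (40 * 120) <= n%:R * lam by apply: ler_wpM2l => //; lra.
have h5 : 0 <= n%:R ^+ 2 :> R by exact: sqr_ge0.
lra.
Qed.

(** Union bound: there are never more than [n] pieces, [D] fails with probability at most [1/24] by
    Markov, and [Z] with at most [61 n / (244 n) + 1/24]; the total is [1/3]. *)
Lemma mean_rejects_uniform (R : realFieldType) (r t : R) b L n x :
  0 < r < 1 -> 40 * 120 <= r * L%:R -> 1 <= t -> t ^+ 2 = n%:R ->
  (1 - r) ^+ L <= 1 / 6 -> (1 - r) ^+ L * L%:R ^+ 2 <= 2 / r ^+ 2 ->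
  x = blocks b (nseq n L) ->
  mask_mean r (size x) (fun m1 => mask_mean2 r (size x) (fun m2 m3 =>
    (~~ accepts (r * L%:R) (3 * 100 * (n%:R + t * (r * L%:R))) n b
         (annotate x m1 m2 m3))%:R)) <= 1 / 3.
Proof.
move=> r01 lam1 t1 tn q6 qL xE; have /andP[r0 r1] := r01.
set N := size x.
have r01' : 0 <= r <= 1 by rewrite !ltW.
have n1 : 1 <= n%:R :> R by rewrite -tn expr_ge1 //; lra.
have n0 : (0 < n)%N by rewrite -(ltr0n R); lra.
pose lam := r * L%:R; rewrite -/lam in lam1 *.
have chn m : size m = N -> (changes b x m < n)%N.
  move=> sm; have [] := @changes_blocks b (nseq n L) m; first by rewrite sm /N xE size_blocks.
  by rewrite -xE size_nseq; lia.
apply: (@le_trans _ _ (mask_mean r N (fun m => (24 * n%:R)^-1 * (r * (errors b x m)%:R) +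
    1 * (((4 * 61) * n%:R)^-1 * bias r lam n (pieces b x m) + 1 / 24 * 1)))).
  apply: le_mask_mean => // m sm.
  have a0 : 0 < 24 * n%:R :> R by lra.
  have h1 := @mean_hits_gt _ r (24 * n%:R) b x m r01' a0 sm.
  have h2 := mean_product_gt r01 lam1 t1 tn (_ : (size (pieces b x m) <= n)%N).
  have {}h2 := h2 ltac:(by rewrite size_pieces; exact: chn).
  rewrite (sumn_pieces _ sm) -/N in h2.
  apply: (@le_trans _ _ (1 * mask_mean2 r N (fun m2 _ => (24 * n%:R < (hits b x m m2)%:R :> R)%R%:R) +
     1 * mask_mean2 r N (fun m2 m3 => (3 * 100 * (n%:R + t * lam) - bias r lam n (pieces b x m) <
      piece_products lam (pieces b x m) m2 m3 - piece_bias r lam (pieces b x m))%R%:R))).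
    rewrite -mask_mean2_lin; apply: le_mask_mean2 => // m2 m3 s2 s3.
    rewrite (accepts_annotate r) // chn //= negb_and -ltnNge -real_ltNge ?num_real //.
    rewrite -[24 * n%:R]natrM ltr_nat.
    by case: (_ < _)%N; case: (_ < _) => /=; lra.
  have -> : mask_mean2 r N (fun m2 _ => (24 * n%:R < (hits b x m m2)%:R :> R)%R%:R) =
      mask_mean r N (fun m2 => (24 * n%:R < (hits b x m m2)%:R :> R)%R%:R).
    by apply: eq_mask_mean => m' _; rewrite mask_mean_cst.
  rewrite [(24 * _)^-1 * _]mulrC [((4 * 61) * _)^-1 * _]mulrC mulr1 !mul1r.
  by rewrite mul1r in h2; exact: lerD h1 h2.
rewrite !mask_mean_lin mask_mean_cst mask_meanZ mean_errors.
have hb := mean_bias_uniform b r01 n0 q6 qL; rewrite -xE in hb.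
have hc : (1 - r) * mask_mean r N (fun m => (changes b x m)%:R) <= n%:R.
  have : mask_mean r N (fun m => (changes b x m)%:R) <= n%:R.
    rewrite -(mask_mean_cst r N n%:R); apply: le_mask_mean => // m sm.
    by rewrite ler_nat ltnW // chn.
  have : 0 <= mask_mean r N (fun m => (changes b x m)%:R).
    by rewrite -(mask_mean_cst r N 0); apply: le_mask_mean.
  by move: (mask_mean _ _ _) => y; nra.
have h1 : (24 * n%:R)^-1 * ((1 - r) * mask_mean r N (fun m => (changes b x m)%:R)) <= 1 / 24.
  by rewrite ler_pdivrMl; lra.
have h2 : ((4 * 61) * n%:R)^-1 * mask_mean r N (fun m => bias r lam n (pieces b x m)) <= 1 / 4.
  by rewrite ler_pdivrMl; [move: hb; rewrite -/N -/lam|]; lra.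
lra.
Qed.

(* Cauchy-Schwarz, in the form [d^2 >= 2 a d - a^2] for every deviation [d]. *)
Lemma bias_ge (R : realFieldType) (r a : R) n L ls : (size ls <= n)%N -> 0 <= a ->
  a * n%:R <= (\sum_(l <- ls) ((l - L) + (L - l)) + (n - size ls) * L)%:R ->
  r ^+ 2 * (a ^+ 2 * n%:R) <= bias r (r * L%:R) n ls.
Proof.
move=> sn a0; rewrite natrD natrM natrB // => aS.
pose S : R := \sum_(l <- ls) (l%:R - L%:R) ^+ 2 + (n%:R - (size ls)%:R) * L%:R ^+ 2.
have -> : bias r (r * L%:R) n ls = r ^+ 2 * S.
  rewrite /bias /piece_bias /S mulrDr mulr_sumr; congr (_ + _); last by ring.
  by apply: eq_bigr => l _; ring.
apply: ler_wpM2l; first exact: sqr_ge0.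
have sn' : 0 <= n%:R - (size ls)%:R :> R by rewrite subr_ge0 ler_nat.
have h1 : 2 * a * (\sum_(l <- ls) ((l - L) + (L - l)))%:R - a ^+ 2 * (size ls)%:R <=
    \sum_(l <- ls) (l%:R - L%:R) ^+ 2.
  elim: ls {aS S sn sn'} => [|l ls IHls]; first by rewrite !big_nil !mulr0 subrr.
  rewrite !big_cons /= natrD -natr1.
  have : 2 * a * (l - L + (L - l))%:R - a ^+ 2 <= (l%:R - L%:R) ^+ 2.
    set d : R := (l - L + (L - l))%:R.
    have -> : (l%:R - L%:R) ^+ 2 = d ^+ 2.
      rewrite /d; case: (leqP l L) => lL.
        have /eqP -> : (l - L == 0)%N by rewrite subn_eq0.
        by rewrite add0n natrB // -sqrrN opprB.
      have /eqP -> : (L - l == 0)%N by rewrite subn_eq0 ltnW.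
      by rewrite addn0 natrB // ltnW.
    by have := sqr_ge0 (d - a); lra.
  by lra.
have h2 : (n%:R - (size ls)%:R) * (2 * a * L%:R - a ^+ 2) <= (n%:R - (size ls)%:R) * L%:R ^+ 2.
  by apply: ler_wpM2l => //; have := sqr_ge0 (a - L%:R); lra.
have := ler_wpM2l (_ : 0 <= 2 * a) aS; rewrite mulr_ge0 // => /(_ isT).
by rewrite /S; lra.
Qed.

Lemma mean_accepts_far (R : realFieldType) (r t eps : R) b L n x m :
  0 < r < 1 -> 40 * 120 <= r * L%:R -> 1 <= t -> t ^+ 2 = n%:R -> 0 < eps ->
  40 * 120 <= r * L%:R * eps ->
  ((1 < n)%N -> 40 * 120 <= r * L%:R * eps ^+ 2 * t) ->
  size x = (n * L)%N -> size m = size x ->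
  eps * (n * L)%:R < (edit_dist x (blocks b (nseq n L)))%:R ->
  mask_mean2 r (size x) (fun m2 m3 =>
    (accepts (r * L%:R) (3 * 100 * (n%:R + t * (r * L%:R))) n b
         (annotate x m m2 m3))%:R) <= 1 / 6.
Proof.
move=> r01 lam1 t1 tn eps0 lam2 lam3 sx sm far; have /andP[r0 r1] := r01.
have r01' : 0 <= r <= 1 by rewrite !ltW.
have n1 : 1 <= n%:R :> R by rewrite -tn expr_ge1 //; lra.
pose lam := r * L%:R; rewrite -/lam in lam1 lam2 lam3 *.
have lam0 : 0 < lam by lra.
set tau := 3 * 100 * _.
have [nch|chn] := leqP n (changes b x m).
  rewrite (@eq_mask_mean2 _ _ _ _ (fun _ _ => 0)) ?mask_mean2_cst; first by lra.
  by move=> m2 m3 s2 s3; rewrite (accepts_annotate r) // ltnNge nch.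
have sn : (size (pieces b x m) <= n)%N by rewrite size_pieces.
have := edit_dist_blocks L sm chn; rewrite -(ler_nat R) -size_pieces.
set S := (\sum_(l <- _) _ + _)%N; rewrite natrD => /(lt_le_trans far) eS.
(* The distance exceeds [2 a n], so either the errors or the length deviations reach [a n]. *)
pose a := eps * L%:R / 2.
have [ea|ea] := leP (a * n%:R) (errors b x m)%:R.
  have re : 40 * 60 * n%:R <= r * (errors b x m)%:R.
    apply: le_trans (ler_wpM2l (ltW r0) ea).
    have -> : r * (a * n%:R) = lam * eps / 2 * n%:R by rewrite /a /lam; ring.
    by rewrite ler_wpM2r //; lra.
  apply: (@le_trans _ _ (4 / (r * (errors b x m)%:R))); last first.
    by rewrite ler_pdivrMr; lra.
  apply: le_trans (@mean_hits_le _ r (24 * n%:R) b x m r01' _ _ sm); [|lra|lra].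
  rewrite (_ : mask_mean _ _ _ = mask_mean2 r (size x) (fun m' _ => ((hits b x m m')%:R <= 24 * n%:R :> R)%R%:R)); last first.
    by apply: eq_mask_mean => m' _; rewrite mask_mean_cst.
  apply: le_mask_mean2 => // m2 m3 s2 s3; rewrite (accepts_annotate r) // -natrM ler_nat.
  by rewrite ler_nat; case: and3P => [[_ -> _]|_].
have {eS} aS : a * n%:R <= S%:R by move: eS ea; rewrite natrM /a; lra.
have L0 : 0 < L%:R :> R by move: lam0; rewrite pmulr_rgt0.
(* For [n = 1] the only piece is all of [x], of length [L], so the length deviations vanish. *)
have n2 : (1 < n)%N.
  rewrite ltnNge; apply/negP => n2; move: aS.
  have {n2} n2 : n = 1%N by apply/eqP; rewrite eqn_leq n2 -(ler1n R).
  have a0 : 0 < a by rewrite /a divr_gt0 // mulr_gt0.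
  have ch0 : changes b x m = 0%N by apply/eqP; rewrite -leqn0 -ltnS -n2.
  rewrite /S; have := sumn_pieces b sm; have := size_pieces b x m; rewrite ch0.
  case: (pieces b x m) => [|l [|l' ls]] //= _; rewrite big_cons big_nil n2.
  rewrite sx n2 mul1n !addn0 => ->; rewrite subnn /= ?mul0n ?addn0 mulr1 mulr0n.
  by rewrite leNgt a0.
have Mge := @bias_ge _ r a n L _ sn (_ : 0 <= a) aS.
have {}Mge := Mge ltac:(by rewrite /a !mulr_ge0 // ltW).
have := var_piece_products_le r01 lam0 sn; rewrite (sumn_pieces _ sm).
rewrite -/lam in Mge *; move: Mge; set M := bias _ _ _ _ => Mge var.
have {lam3}lam3 := lam3 n2.
(* This is [sqrt n lam], the scale of the standard deviation in the threshold. *)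
pose c := t * lam.
have c0 : 0 < c by rewrite mulr_gt0 //; lra.
have tn0 : 0 < n%:R :> R by lra.
have M1 : 400 * 400 * n%:R <= M.
  apply: le_trans Mge; have -> : r ^+ 2 * (a ^+ 2 * n%:R) = (lam * eps / 2) ^+ 2 * n%:R by rewrite /a /lam; ring.
  apply: ler_wpM2r; first exact: ler0n.
  by have := sqr_ge0 (lam * eps / 2 - 400); lra.
have M2 : 30 * 40 * c <= M.
  apply: le_trans Mge; have -> : r ^+ 2 * (a ^+ 2 * n%:R) = (lam * eps ^+ 2 * t) / 4 * c.
    by rewrite /a /c /lam -tn; field.
  by rewrite ler_wpM2r ?(ltW c0) //; lra.
have lc : lam <= c by rewrite /c ler_peMl // ltW.
have h2 : n%:R * lam ^+ 2 = c ^+ 2 by rewrite /c -tn; ring.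
have T1 : M / 2 <= M - tau.
  by move: M1 M2 tn0; rewrite /tau -/c; clear; lra.
clear Mge far ea aS a lam2 eps0 lam3 t1 tn n1.
have M0 : 0 < M by lra.
have T0 : 0 < M - tau by lra.
apply: (@le_trans _ _ (mask_mean2 r (size x) (fun m2 m3 =>
    (piece_products lam (pieces b x m) m2 m3 - piece_bias r lam (pieces b x m) <= tau - M)%R%:R))).
  apply: le_mask_mean2 => // m2 m3 s2 s3; rewrite (accepts_annotate r) //.
  by rewrite ler_nat -/M; case: and3P => [[_ _ ->]|_].
apply: (le_trans (mean_chebyshev r01' T0 var _)) => [m2 m3 _ _ h|].
  by rewrite -[leRHS]sqrrN ler_sqr ?nnegrE ?(ltW T0) //; lra.
(* The variance is at most [M^2 / 24] and the deviation at least [M / 2], whence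
   [4 / 24 = 1 / 6]. *)
apply: (@le_trans _ _ (M ^+ 2 / 24 / (M - tau) ^+ 2)); last first.
  rewrite ler_pdivrMr ?exprn_gt0 //.
  have : (M / 2) ^+ 2 <= (M - tau) ^+ 2 by rewrite ler_sqr ?nnegrE; lra.
  by lra.
rewrite ler_wpM2r ?invr_ge0 ?sqr_ge0 //.
have h1 : M ^+ 2 / lam <= M ^+ 2 / (40 * 120).
  by rewrite ler_wpM2l ?sqr_ge0 // lef_pV2 ?posrE //; lra.
have h3 : (30 * 40 * c) ^+ 2 <= M ^+ 2 by rewrite ler_sqr ?nnegrE //; lra.
have h4 : 400 * 400 * M <= M ^+ 2 by rewrite expr2; apply: ler_wpM2r; lra.
have h5 : 30 * 40 * lam * M <= M ^+ 2.
  by rewrite expr2; apply: ler_wpM2r; lra.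
lra.
Qed.

(** * The testers *)

(** [(1 - r)^L] is at most [exp (- lam)], and [exp lam >= 1 + lam^2 / 2]. *)
Lemma kept_rates_small (R : realType) (r : R) L : 0 < r < 1 -> 4 <= r * L%:R ->
  (1 - r) ^+ L <= 1 / 6 /\ (1 - r) ^+ L * L%:R ^+ 2 <= 2 / r ^+ 2.
Proof.
move=> /andP[r0 r1]; set lam := r * L%:R => lam4.
have lam0 : 0 <= lam by lra.
have q0 : 0 <= (1 - r) ^+ L by rewrite exprn_ge0 // subr_ge0 ltW.
have qe : (1 - r) ^+ L * expR lam <= 1.
  rewrite /lam [r * _]mulrC expRM_natl -exprMn exprn_ile1 //.
    by rewrite mulr_ge0 ?expR_ge0 // subr_ge0 ltW.
  rewrite -[leRHS](@expRxMexpNx_1 _ r) mulrC ler_wpM2l ?expR_ge0 //.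
  by have := expR_ge1Dx (- r).
have qlam : (1 - r) ^+ L * lam ^+ 2 <= 2.
  have := expR_ge1Dxn 1 lam0 => e2.
  have : (1 - r) ^+ L * (1 + lam ^+ 2 / 2) <= 1 by apply: le_trans qe; apply: ler_wpM2l.
  lra.
split.
  have : (1 - r) ^+ L * 16 <= (1 - r) ^+ L * lam ^+ 2 by apply: ler_wpM2l => //; have := sqr_ge0 (lam - 4); lra.
  lra.
by rewrite ler_pdivlMr ?exprn_gt0 // -mulrA -exprMn [L%:R * r]mulrC.
Qed.

Lemma le_colour_mean (R : realFieldType) (r : R) y F G : 0 < r < 1 ->
  (forall l, F l <= G l) -> colour_mean r y F <= colour_mean r y G.
Proof.
move=> /andP[r0 r1]; elim: y F G => [|b y IHy] F G FG /=; first exact: FG.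
apply: ler_sum => c _; apply: ler_wpM2l; last exact: IHy.
rewrite divr_ge0 //.
  by rewrite /colour_prob !mulr_ge0 //; case: ifP => _; rewrite ?subr_ge0 ltW.
by rewrite subr_ge0 exprn_ile1 ?subr_ge0 ?ltW // gtrDl oppr_lt0.
Qed.

Lemma colour_mean_cst (R : realFieldType) (r a : R) y : 0 < r < 1 ->
  colour_mean r y (fun=> a) = a.
Proof.
move=> /andP[r0 r1]; elim: y => [|b y IHy] //=.
under eq_bigr => c _ do rewrite IHy.
have rho0 : 1 - (1 - r) ^+ 3 != 0.
  have -> : 1 - (1 - r) ^+ 3 = r * (3 - 3 * r + r ^+ 2) by ring.
  by rewrite mulf_neq0 ?gt_eqF //; nra.
by rewrite sum_colour /= !big_bool /= /colour_prob /=; field.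
Qed.

Lemma mask_mean_full (R : realFieldType) (r : R) N F : 0 <= r <= 1 ->
  (forall m, 0 <= F m) -> r ^+ N * F (nseq N true) <= mask_mean r N F.
Proof.
move=> /andP[r0 r1]; elim: N F => [|N IHN] F F0; first by rewrite expr0 mul1r.
rewrite exprS -mulrA /= -[leLHS]addr0; apply: lerD.
  by apply: ler_wpM2l => //; exact: (IHN (fun m => F (true :: m))).
rewrite mulr_ge0 ?subr_ge0 // -(mask_mean_cst r N 0).
by apply: le_mask_mean => //; rewrite r0.
Qed.

Lemma bernoulli (R : realFieldType) (y : R) N : 0 <= y <= 1 ->
  1 - N%:R * y <= (1 - y) ^+ N.
Proof.
move=> /andP[y0 y1]; elim: N => [|N IHN]; first by rewrite mul0r subr0 expr0.
have := ler_wpM2l (_ : 0 <= 1 - y) IHN; rewrite subr_ge0 => /(_ y1).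
rewrite exprS -natr1; have := mulr_ge0 (ler0n R N) (sqr_ge0 y); lra.
Qed.

Lemma edit_dist_size x y : size x = size y -> (edit_dist x y <= size x)%N.
Proof.
move=> xy; apply: edit_dist_le; elim: x y xy => [|b x IHx] [|c y] //= [/IHx xy].
exists (c :: x); first exact: (edit_substitution [::]).
exact: (edit_path_cat [:: c]).
Qed.

Lemma size_uniform_blocks b N n : (n %| N)%N -> size (blocks b (nseq n (N %/ n)%N)) = N.
Proof. by move=> nN; rewrite size_blocks sumn_nseq divnK. Qed.

Lemma tester_trivial (R : realType) N (eps rho : R) (Psi : {set N.-tuple bool}) :
  0 < rho < 1 -> (forall x, x \notin far_rel_edit eps Psi) ->
  exists A : 1.-tuple (seq bool) -> R,
    trace_tester Psi (far_rel_edit eps Psi) rho (2 / 3) A.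
Proof.
move=> /andP[r0 r1] far0; exists (fun=> 1); split.
- by move=> t; rewrite ler01 lexx.
- by move=> x _; rewrite trace_expectation1 mask_mean_cst; lra.
- by move=> x; rewrite (negPf (far0 x)).
Qed.

(** By Bernoulli nothing is deleted with probability at least [1 - N / (3 N) = 2/3], and then the
    trace is [x] itself. *)
Lemma tester_dense (R : realType) N n (eps : R) :
  let Psi := uniform_block_strings N n in
  (0 < N)%N -> (n %| N)%N -> 0 < eps ->
  exists A : 1.-tuple (seq bool) -> R,
    trace_tester Psi (far_rel_edit eps Psi) (1 - (3 * N%:R)^-1) (2 / 3) A.
Proof.
move=> Psi N0 nN eps0; set rho := 1 - _.
have y01 : 0 <= ((3 * N%:R)^-1 : R) <= 1.
  rewrite invr_ge0 mulr_ge0 //= invf_le1 ?mulr_gt0 ?ltr0n //.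
  by have : 1 <= N%:R :> R by [rewrite ler1n]; lra.
have r01 : 0 <= rho <= 1 by rewrite /rho; move: y01; lra.
have full : 2 / 3 <= rho ^+ N.
  apply: le_trans (bernoulli N y01).
  have N1 : N%:R != 0 :> R by rewrite pnatr_eq0 -lt0n.
  have -> : N%:R * (3 * N%:R)^-1 = 1 / 3 :> R by field.
  lra.
pose u b := blocks b (nseq n (N %/ n)%N).
pose a (y : seq bool) : R := ((y == u true) || (y == u false))%:R.
exists (fun t => a (thead t)); split.
- by move=> t; rewrite /a ler0n lern1 leq_b1.
- move=> x /uniformP[b xb]; rewrite trace_expectation1.
  apply: (@le_trans _ _ (rho ^+ N * a x)).
    by rewrite /a xb -/(u b); case: b {xb}; rewrite eqxx ?orbT mulr1.
  have := @mask_mean_full _ _ N (fun m => a (mask m x)) r01.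
  by rewrite mask_true ?size_tuple //; apply => m; rewrite ler0n.
- move=> x xfar; rewrite trace_expectation1.
  apply: (@le_trans _ _ (rho ^+ N * (1 - a x))); last first.
    have := @mask_mean_full _ _ N (fun m => 1 - a (mask m x)) r01.
    by rewrite mask_true ?size_tuple //; apply => m; rewrite subr_ge0 lern1 leq_b1.
  have xu b : (tval x == u b) = false.
    apply/negbTE/eqP => xb; have [_] := far_edit_dist b nN eps0 xfar.
    rewrite -/(u b) -xb.
    have -> : edit_dist x x = 0%N by apply/eqP; rewrite -leqn0; apply: edit_dist_le.
    by rewrite mulr0n ltNge mulr_ge0 ?(ltW eps0).
  by rewrite /a !xu subr0 mulr1.
Qed.

(** The first symbol is unknown, so both initial guesses are tried and one acceptance suffices. A
    uniform string needs only its own guess; for a far string the two errors of [1/6] add up to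
    [1/3]. *)
Lemma tester_colours (R : realType) N n (eps r t : R) :
  let Psi := uniform_block_strings N n in
  let lam := r * (N %/ n)%N%:R in
  (n %| N)%N -> 0 < eps -> 0 < r < 1 -> 1 <= t -> t ^+ 2 = n%:R ->
  40 * 120 <= lam -> 40 * 120 <= lam * eps ->
  ((1 < n)%N -> 40 * 120 <= lam * eps ^+ 2 * t) ->
  exists A : 1.-tuple (seq bool) -> R,
    trace_tester Psi (far_rel_edit eps Psi) (1 - (1 - r) ^+ 3) (2 / 3) A.
Proof.
move=> Psi lam nN eps0 r01 t1 tn lam1 lam2 lam3; have /andP[r0 r1] := r01.
have r01' : 0 <= r <= 1 by rewrite !ltW.
pose acc := accepts lam (3 * 100 * (n%:R + t * lam)) n.
pose F l : R := (acc true l || acc false l)%:R.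
have F01 l : 0 <= F l <= 1 by rewrite ler0n lern1 leq_b1.
have [q6 qL] : (1 - r) ^+ (N %/ n)%N <= 1 / 6 /\ (1 - r) ^+ (N %/ n)%N * (N %/ n)%N%:R ^+ 2 <= 2 / r ^+ 2.
  by apply: kept_rates_small => //; rewrite -/lam; lra.
have sN (x : N.-tuple bool) : size x = (n * (N %/ n))%N by rewrite size_tuple mulnC divnK.
exists (fun s => colour_mean r (thead s) F); split.
- move=> s; rewrite -{1}(colour_mean_cst 0 (thead s) r01) -[in X in _ && (_ <= X)](colour_mean_cst 1 (thead s) r01).
  by apply/andP; split; apply: le_colour_mean => // l; have /andP[] := F01 l.
- move=> x /uniformP[b xb].
  rewrite trace_expectation1 -[X in mask_mean _ X](size_tuple x) (colour_mean_mask _ _ r01).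
  have := mean_rejects_uniform r01 lam1 t1 tn q6 qL xb; rewrite -/lam -/acc => rej.
  apply: (@le_trans _ _ (mask_mean r (size x) (fun m1 => 1 * 1 + -1 * mask_mean2 r (size x)
      (fun m2 m3 => (~~ acc b (annotate x m1 m2 m3))%:R)))).
    by rewrite mask_mean_lin mask_mean_cst; move: rej; rewrite -/lam -/acc; lra.
  apply: le_mask_mean => // m1 s1.
  rewrite (_ : 1 * 1 + _ = mask_mean2 r (size x) (fun m2 m3 =>
    1 * 1 + -1 * (~~ acc b (annotate x m1 m2 m3))%:R)); last first.
    by rewrite mask_mean2_lin mask_mean2_cst.
  apply: le_mask_mean2 => // m2 m3 s2 s3; rewrite /F /acc !accepts_kept -/acc.
  by case: b {xb rej}; case: (acc true _); case: (acc false _) => /=; lra.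
- move=> x xfar.
  rewrite trace_expectation1.
  rewrite (@eq_mask_mean _ _ _ _ (fun m => 1 * 1 + -1 * colour_mean r (mask m x) F)); last by move=> m _; rewrite mul1r mulN1r.
  rewrite mask_mean_lin mask_mean_cst -[X in mask_mean _ X](size_tuple x) (colour_mean_mask _ _ r01).
  suff : mask_mean r (size x) (fun m1 => mask_mean2 r (size x) (fun m2 m3 =>
      F [seq e <- annotate x m1 m2 m3 | kept e])) <= 1 / 3 by lra.
  rewrite -[leRHS](mask_mean_cst r (size x)); apply: le_mask_mean => // m1 s1.
  have accb b : mask_mean2 r (size x) (fun m2 m3 => (acc b (annotate x m1 m2 m3))%:R) <= 1 / 6.
    have [_ farb] := far_edit_dist b nN eps0 xfar.
    apply: mean_accepts_far lam2 lam3 (sN x) s1 _ => //.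
    by rewrite [(n * _)%N]mulnC divnK.
  apply: (@le_trans _ _ (1 * mask_mean2 r (size x) (fun m2 m3 => (acc true (annotate x m1 m2 m3))%:R) +
    1 * mask_mean2 r (size x) (fun m2 m3 => (acc false (annotate x m1 m2 m3))%:R))).
    rewrite -mask_mean2_lin; apply: le_mask_mean2 => // m2 m3 s2 s3.
    rewrite /F /acc !accepts_kept -/acc.
    by case: (acc true _); case: (acc false _) => /=; lra.
  by have := accb true; have := accb false; lra.
Qed.

Theorem theorem7p15 (R : realType) :
  exists C : R, 0 < C /\
  forall (N n : nat) (eps : R), (n %| N)%N -> 0 < eps ->
  let Psi := uniform_block_strings N n in
  exists rho : R,
    [/\ 0 < rho, rho < 1,
        rho * N%:R <= C * (n%:R / eps + n%:R / (eps ^+ 2 * ln n%:R))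
      & exists A : 1.-tuple (seq bool) -> R,
          trace_tester Psi (far_rel_edit eps Psi) rho (2 / 3) A].
Proof.
(* The factor [3] comes from [rho <= 3 r], the rest from the bound [nlam] on [n lam]. *)
exists (3 * (2 * (40 * 120))); split; first by rewrite !mulr_gt0.
move=> N n eps nN eps0 Psi; set X := n%:R / eps + _.
have ln0 : 0 <= ln n%:R :> R.
  by case: n nN @Psi @X => [|n] _ _ _; [rewrite ln0|rewrite ln_ge0 // ler1n].
have ne0 : 0 <= n%:R / eps by rewrite divr_ge0 // ltW.
have nl0 : 0 <= n%:R / (eps ^+ 2 * ln n%:R) by rewrite divr_ge0 // mulr_ge0 // sqr_ge0.
have [N0|N0] := posnP N.
  exists (1 / 2); split; [lra|lra| |].
    by rewrite N0 mulr0 !mulr_ge0 // addr_ge0.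
  apply: tester_trivial => [|x]; first by lra.
  by apply/negP => /(far_edit_dist true nN eps0)[Ngt0 _]; move: Ngt0; rewrite N0.
have n0 : (0 < n)%N := dvdn_gt0 N0 nN.
have N0' : 0 < N%:R :> R by rewrite ltr0n.
have n0' : 0 < n%:R :> R by rewrite ltr0n.
(* Strings of length [N] are at edit distance at most [N], so nothing is far when [eps >= 1]. *)
have [eps1|eps1] := leP 1 eps.
  have ne1 : 0 < n%:R / eps by rewrite divr_gt0.
  exists (n%:R / eps / (2 * N%:R)).
  have Nn : n%:R <= N%:R :> R by rewrite ler_nat dvdn_leq.
  have neN : n%:R / eps <= N%:R by rewrite ler_pdivrMr // (le_trans Nn) // ler_peMr // ltW.
  have rho01 : 0 < n%:R / eps / (2 * N%:R) < 1.
    apply/andP; split; first by rewrite divr_gt0 // mulr_gt0.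
    by rewrite ltr_pdivrMr; [lra|rewrite mulr_gt0].
  have /andP[? ?] := rho01; split=> //.
    have -> : n%:R / eps / (2 * N%:R) * N%:R = n%:R / eps / 2 by field; rewrite !gt_eqF.
    by rewrite /X; lra.
  apply: tester_trivial => // x; apply/negP => /(far_edit_dist true nN eps0)[_].
  rewrite ltNge => /negP; apply.
  apply: (@le_trans _ _ N%:R); last by rewrite ler_peMl // ltW.
  by rewrite ler_nat (leq_trans (edit_dist_size _)) ?size_uniform_blocks ?size_tuple.
set L := (N %/ n)%N.
have NL : N%:R = n%:R * L%:R :> R by rewrite -natrM mulnC divnK.
have L0 : 0 < L%:R :> R by rewrite ltr0n divn_gt0 // dvdn_leq.
(* The factor 2 in the second summand pays for [ln n <= 2 sqrt n]. For [n = 1] that summand is zero,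
   as [ln 1 = 0] and zero has inverse zero. *)
pose lam := 40 * 120 / eps + 2 * (40 * 120) / (eps ^+ 2 * ln n%:R).
have nlam : n%:R * lam <= 2 * (40 * 120) * X by rewrite /lam /X; lra.
have l2 : 0 <= 2 * (40 * 120) / (eps ^+ 2 * ln n%:R) by apply: divr_ge0; [lra|rewrite mulr_ge0 ?sqr_ge0].
(* If [lam >= L], almost all of [x] may be retained. *)
have [Llam|lamL] := leP L%:R lam.
  exists (1 - (3 * N%:R)^-1).
  have N1 : 1 <= N%:R :> R by rewrite ler1n.
  have i0 : 0 < (3 * N%:R)^-1 :> R by rewrite invr_gt0 mulr_gt0.
  have i1 : (3 * N%:R)^-1 < 1 :> R by rewrite invf_lt1 ?mulr_gt0 //; lra.
  split; [lra|lra| |exact: tester_dense].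
  apply: (@le_trans _ _ N%:R); first by rewrite ler_piMl //; lra.
  rewrite NL; apply: (@le_trans _ _ (n%:R * lam)); first by rewrite ler_wpM2l.
  by apply: (le_trans nlam); rewrite /X; lra.
pose r := lam / L%:R.
have lam1 : 40 * 120 <= lam * eps.
  have -> : lam * eps = 40 * 120 + 2 * (40 * 120) / (eps ^+ 2 * ln n%:R) * eps.
    by rewrite /lam; move: (_ / (_ * ln _)) => y; field; rewrite gt_eqF.
  by have := mulr_ge0 l2 (ltW eps0); lra.
have lam0 : 40 * 120 <= lam.
  apply: le_trans lam1 _; rewrite ler_piMr ?(ltW eps1) //.
  by rewrite addr_ge0 // divr_ge0 ?mulr_ge0 // ltW.
have rL : r * L%:R = lam by rewrite /r divfK ?gt_eqF.
have lam_gt0 : 0 < lam by lra.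
have r01 : 0 < r < 1 by rewrite divr_gt0 //= ltr_pdivrMr // mul1r.
have /andP[r0 r1] := r01.
exists (1 - (1 - r) ^+ 3).
have q01 : 0 < (1 - r) ^+ 3 by rewrite exprn_gt0 // subr_gt0.
have q1 : 1 - (1 - r) ^+ 3 <= 3 * r
  by have := @bernoulli _ r 3; rewrite (ltW r0) (ltW r1) => /(_ isT); lra.
split; [|lra| |].
- by rewrite subr_gt0 exprn_ilt1 ?subr_ge0 ?(ltW r1) // gtrDl oppr_lt0.
- apply: (@le_trans _ _ (3 * (n%:R * lam))); last by rewrite -[leRHS]mulrA ler_pM2l.
  by rewrite NL -rL; have := ler_wpM2r (mulr_ge0 (ltW n0') (ltW L0)) q1; lra.
- have sq : Num.sqrt n%:R ^+ 2 = n%:R :> R by rewrite sqr_sqrtr.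
  have t1 : 1 <= Num.sqrt n%:R :> R by rewrite -[leLHS]sqrtr1 ler_wsqrtr // ler1n.
  apply: (@tester_colours _ N n eps r (Num.sqrt n%:R)) => //; rewrite -/L rL //.
  move=> n1; have lnn : 0 < ln n%:R :> R by rewrite ln_gt0 // ltr1n.
  (* This is [ln x <= x] at [x = sqrt n]. *)
  have ln2 : ln n%:R <= 2 * Num.sqrt n%:R :> R.
    have t0 : 0 < Num.sqrt n%:R :> R by lra.
    have -> : ln n%:R = 2 * ln (Num.sqrt n%:R) :> R by rewrite -{1}sq lnXn // mulr2n; ring.
    by have := ln_sublinear t0; lra.
  have -> : lam * eps ^+ 2 * Num.sqrt n%:R =
      40 * 120 * (eps * Num.sqrt n%:R) + 40 * 120 * (2 * Num.sqrt n%:R / ln n%:R).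
    by rewrite /lam; field; rewrite !gt_eqF.
  rewrite -[leLHS]add0r lerD // ?mulr_ge0 ?(ltW eps0) ?sqrtr_ge0 //.
  by rewrite ler_peMr // ler_pdivlMr // mul1r.
Qed.
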